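(* Let $\Omega\subset\mathbb{R}^m$ be a bounded domain (open and connected), let $J:\mathbb{R}^m\to[0,\infty)$ be an even measurable function such that $\int_{\mathbb{R}^m\setminus B_\rho(0)}J(h)|h|\,dh<\infty$ for some $\rho>0$, and let $W:\mathbb{R}^m\times\mathbb{R}\to[0,\infty)$ satisfy (W1), (W2) and (W5) of the context. For $\epsilon>0$ and measurable $u:\Omega\to\mathbb{R}$ let $$F_\epsilon(u):=\frac1{4\epsilon}\int_{\Omega\times\Omega}\epsilon^{-m}J\Big(\frac{x'-x}{\epsilon}\Big)|u(x')-u(x)|^2\,dx'dx+\frac1\epsilon\int_\Omega W(x,u(x))\,dx.$$ Consider a family of (measurable) functions $u_\epsilon:\Omega\to\mathbb{R}$ such that $\limsup_{\epsilon\to0^+}F_\epsilon(u_\epsilon)<\infty$. Then there exists $u\in CP(\Omega;\mathbf{z}(x))$ such that, up to the extraction of a (non-relabelled) subsequence, $u_\epsilon\to u$ in $L^1(\Omega)$.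
   Context: Assumptions on $W:\mathbb{R}^m\times\mathbb{R}\to[0,\infty)$, $(x,t)\mapsto W(x,t)$: (W1) $W$ is continuous, twice continuously differentiable with respect to $t$, and $\partial_tW$ is locally $\alpha$-Hölder continuous for some $\alpha\in(1/2,1]$; moreover $W(x,t)=0$ if and only if $t\in\mathbf{z}(x):=\{z_1(x),z_2(x)\}$, where $z_1,z_2:\mathbb{R}^m\to\mathbb{R}$ are $\alpha$-Hölder continuous (same $\alpha$). For every compact $K\subset\mathbb{R}^m$ there is $\delta_K\in(0,1]$ with: (W2) $\min_{x\in K}|z_1(x)-z_2(x)|>8\delta_K$ and $z_1(x)<z_2(x)$ for every $x\in K$; (W5) $W(x,t)\ge\delta_K|t|$ for every $x\in K$ and every $|t|>\frac1{\delta_K}$. $B_\rho(0)$ is the ball of radius $\rho$ centred at the origin. $CP(\Omega;\mathbf{z}(x))$ is the set of measurable $u:\Omega\to\mathbb{R}$ for which there is a set $E$ of finite perimeter in $\Omega$ with $u=z_1$ a.e. on $E$ and $u=z_2$ a.e. on $\Omega\setminus E$.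
   Formalization: The kernel J is additionally assumed not to vanish almost everywhere; for J = 0 a.e. the claim is false, since functions oscillating ever faster between z_1 and z_2 have zero energy but no L^1-convergent subsequence. *)

(* Defs.v *)
From HB Require Import structures.
From mathcomp Require Import all_boot all_order all_algebra.
From mathcomp Require Import all_classical all_reals all_analysis.
From mathcomp Require Import measurable_realfun.

Set Implicit Arguments.
Unset Strict Implicit.
Unset Printing Implicit Defensive.

Import Order.TTheory GRing.Theory Num.Theory.
Import numFieldNormedType.Exports.

Local Open Scope classical_set_scope.
Local Open Scope ring_scope.

(* The Borel sigma-algebra of R^n, generated by the coordinate maps (as the
   library does for n.-tuple T). *)
Fact rV_display : measure_display. Proof. exact: default_measure_display. Qed.

Section rV_measurable.
Context {R : realType} (n : nat).

Definition rV_coord (i : 'I_n) (x : 'rV[R]_n) : measurableTypeR R := x ord0 i.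

Let rV_set0 : g_sigma_preimage rV_coord set0.
Proof. exact: sigma_algebra0. Qed.

Let rV_setC A : g_sigma_preimage rV_coord A -> g_sigma_preimage rV_coord (~` A).
Proof. exact: sigma_algebraC. Qed.

Let rV_bigcup (F : (set 'rV[R]_n)^nat) :
  (forall i, g_sigma_preimage rV_coord (F i)) ->
  g_sigma_preimage rV_coord (\bigcup_i (F i)).
Proof. exact: sigma_algebra_bigcup. Qed.

HB.instance Definition _ := @isMeasurable.Build rV_display
  'rV[R]_n (g_sigma_preimage rV_coord) rV_set0 rV_setC rV_bigcup.

Lemma measurable_rV_coord i : measurable_fun [set: 'rV[R]_n] (rV_coord i).
Proof.
move=> _ Y mY; rewrite setTI; apply: sub_sigma_algebra => /=.
rewrite -bigcup_seq/=; exists i => /=; first by rewrite mem_index_enum.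
by exists Y => //; rewrite setTI.
Qed.

Lemma measurable_fun_rV d (T : measurableType d) (f : T -> 'rV[R]_n) :
  (forall i, measurable_fun [set: T] (rV_coord i \o f)) ->
  measurable_fun [set: T] f.
Proof.
move=> mf _ A mA; rewrite setTI.
suff : g_sigma_preimage rV_coord `<=` [set B | measurable (f @^-1` B)] by exact.
apply: smallest_sub.
  split => /=.
  - by rewrite preimage_set0.
  - by move=> B mB; rewrite setTD preimage_setC; exact: measurableC.
  - by move=> F mF; rewrite preimage_bigcup; exact: bigcup_measurable.
rewrite -bigcup_seq => B [i /= _ [C mC <-]].
by rewrite setTI -comp_preimage -[X in measurable X]setTI; exact: mf.
Qed.

End rV_measurable.

(* Lebesgue measure on R^n, by recursion along R^(n+1) = R x R^n. *)
Section rV_cons.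
Context {R : realType} (n : nat).

Definition rV_cons (p : measurableTypeR R * 'rV[R]_n) : 'rV[R]_n.+1 :=
  row_mx (const_mx p.1 : 'rV[R]_1) p.2.

Definition rV_uncons (x : 'rV[R]_n.+1) : measurableTypeR R * 'rV[R]_n :=
  (x ord0 ord0, \row_j x ord0 (lift ord0 j)).

Lemma rV_cons0 p : rV_cons p ord0 ord0 = p.1.
Proof.
have -> : (ord0 : 'I_n.+1) = lshift n (ord0 : 'I_1) by exact/ord_inj.
by apply: (etrans (row_mxEl _ _ _ _)); rewrite mxE.
Qed.

Lemma rV_consS p j : rV_cons p ord0 (lift ord0 j) = p.2 ord0 j.
Proof.
have -> : (lift ord0 j : 'I_n.+1) = rshift 1 j by exact/ord_inj.
exact: (etrans (row_mxEr _ _ _ _)).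
Qed.

Lemma rV_consK : cancel rV_cons rV_uncons.
Proof.
move=> p; rewrite /rV_uncons rV_cons0 [RHS]surjective_pairing; congr pair.
by apply/rowP => j; rewrite mxE rV_consS.
Qed.

Lemma rV_unconsK : cancel rV_uncons rV_cons.
Proof.
move=> x; apply/rowP => i; case: (unliftP ord0 i) => [j ->|->].
  by rewrite rV_consS mxE.
by rewrite rV_cons0.
Qed.

Lemma measurable_rV_cons : measurable_fun setT rV_cons.
Proof.
apply: measurable_fun_rV => i; case: (unliftP ord0 i) => [j ->|->].
  rewrite (_ : _ \o _ = rV_coord j \o snd).
    by apply: measurableT_comp => //; exact: measurable_rV_coord.
  by apply/funext => p; rewrite /= /rV_coord rV_consS.
rewrite (_ : _ \o _ = fst) => //.
by apply/funext => p; rewrite /= /rV_coord rV_cons0.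
Qed.

Lemma measurable_rV_uncons : measurable_fun setT rV_uncons.
Proof.
apply: measurable_fun_pair.
  exact: measurable_rV_coord.
apply: measurable_fun_rV => i.
rewrite (_ : _ \o _ = rV_coord (lift ord0 i)); first exact: measurable_rV_coord.
by apply/funext => x; rewrite /= /rV_coord mxE.
Qed.

Section step.
Variable mu : {sigma_finite_measure set 'rV[R]_n -> \bar R}.
Local Open Scope ereal_scope.

Definition lebesgue_rVS : set 'rV[R]_n.+1 -> \bar R :=
  pushforward ((@lebesgue_measure R) \x mu) rV_cons.

Let lebesgue_rVS0 : lebesgue_rVS set0 = 0.
Proof. by rewrite /lebesgue_rVS /pushforward preimage_set0 measure0. Qed.

Let lebesgue_rVS_ge0 A : 0 <= lebesgue_rVS A.
Proof. by rewrite /lebesgue_rVS /pushforward measure_ge0. Qed.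

Let mcons (B : set 'rV[R]_n.+1) :
  measurable B -> measurable (rV_cons @^-1` B).
Proof. by rewrite -[X in _ -> measurable X]setTI; exact: measurable_rV_cons. Qed.

Let lebesgue_rVS_sigma_additive : semi_sigma_additive lebesgue_rVS.
Proof.
move=> F mF tF mUF; rewrite /lebesgue_rVS /pushforward preimage_bigcup.
apply: measure_semi_sigma_additive.
- move=> k; apply: mcons; exact: mF.
- apply/trivIsetP => /= i j _ _ ij; rewrite -preimage_setI.
  by move/trivIsetP : tF => /(_ _ _ _ _ ij) ->//; rewrite preimage_set0.
- by rewrite -preimage_bigcup; exact: mcons.
Qed.

HB.instance Definition _ := isMeasure.Build _ _ _ lebesgue_rVS
  (lebesgue_rVS0) lebesgue_rVS_ge0 lebesgue_rVS_sigma_additive.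

Let lebesgue_rVS_sigma_finite : sigma_finite setT lebesgue_rVS.
Proof.
have /sigma_finiteP[F [TF ndF Foo]] := sigma_finiteT (@lebesgue_measure R).
have /sigma_finiteP[G [TG ndG Goo]] := sigma_finiteT mu.
exists (fun k => rV_uncons @^-1` (F k `*` G k)).
  rewrite -preimage_bigcup (_ : \bigcup_k _ = setT) ?preimage_setT//.
  rewrite -subTset => -[x y] _.
  have [k _ Fkx] : (\bigcup_k F k) x by rewrite -TF.
  have [l _ Gly] : (\bigcup_k G k) y by rewrite -TG.
  exists (maxn k l) => //; split => /=.
  - by move: x Fkx; exact/subsetPset/ndF/leq_maxl.
  - by move: y Gly; exact/subsetPset/ndG/leq_maxr.
move=> k; have [mFk Fkoo] := Foo k; have [mGk Gkoo] := Goo k.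
have mFG : measurable (F k `*` G k) by exact: measurableX.
split; first by rewrite -[X in measurable X]setTI; exact: measurable_rV_uncons.
rewrite /lebesgue_rVS /pushforward -comp_preimage.
rewrite (_ : rV_uncons \o rV_cons = id); last by apply/funext; exact: rV_consK.
rewrite preimage_id product_measure1E//.
by rewrite lte_mul_pinfty// ge0_fin_numE.
Qed.

HB.instance Definition _ := Measure_isSigmaFinite.Build _ _ _ lebesgue_rVS
  lebesgue_rVS_sigma_finite.

End step.
End rV_cons.

Fixpoint lebesgue_rV {R : realType} (n : nat) :
    {sigma_finite_measure set 'rV[R]_n -> \bar R} :=
  match n with
  | 0 => \d_(0 : 'rV[R]_0)
  | n'.+1 => lebesgue_rVS (lebesgue_rV n')
  end.

Lemma lebesgue_rV_box {R : realType} (n : nat)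
    (A : 'I_n -> set (measurableTypeR R)) :
  (forall i, measurable (A i)) ->
  (lebesgue_rV n [set x | forall i, A i (rV_coord i x)] =
   \prod_(i < n) lebesgue_measure (A i))%E.
Proof.
elim: n A => [|n ih] A mA.
  rewrite big_ord0 /= (_ : [set _ | _] = setT) ?diracT//.
  by apply/seteqP; split => // x _ [].
rewrite big_ord_recl -ih// /= /lebesgue_rVS /pushforward -product_measure1E//.
  congr (_ _); apply/seteqP; split.
    move=> p Ap; split; first by have := Ap ord0; rewrite /rV_coord rV_cons0.
    by move=> j /=; have := Ap (lift ord0 j); rewrite /rV_coord rV_consS.
  move=> p [Ap0 Ap] i; case: (unliftP ord0 i) => [j ->|->].
    by rewrite /rV_coord rV_consS; exact: Ap.
  by rewrite /rV_coord rV_cons0.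
rewrite (_ : [set _ | _] =
    \bigcap_(i in [set: 'I_n]) (rV_coord i @^-1` A (lift ord0 i))).
  apply: fin_bigcap_measurable => // i _.
  by rewrite -[X in measurable X]setTI; exact: measurable_rV_coord.
by apply/seteqP; split => [x Ax i _|x Ax i]; exact: Ax.
Qed.

Section definitions.
Context {R : realType} (m : nat).
Local Notation V := 'rV[R]_m.
Local Notation leb := (lebesgue_rV m).
Implicit Types (D E Omega : set V) (J z f u v : V -> R) (phi : V -> V).

(* The library's norm on 'rV[R]_m is the sup norm. *)
Definition enorm (x : V) : R := Num.sqrt (\sum_(i < m) x ord0 i ^+ 2).

Definition eball (r : R) : set V := [set x | enorm x < r].

(* Lebesgue (not merely Borel) measurability.  The base sigma-algebra of leb
   is the Borel one; on a nonnegative function equal a.e. to a Borel function,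
   the library integral (a supremum over Borel simple functions below it) is
   still the Lebesgue integral. *)
Definition lebesgue_measurable_set : set (set V) := completed_algebra_gen leb.

Definition lebesgue_measurable_fun D f :=
  forall Y : set (measurableTypeR R), measurable Y ->
    lebesgue_measurable_set (D `&` f @^-1` Y).

Definition partial_deriv (i : 'I_m) f (x : V) : R := 'D_(delta_mx 0 i) f x.

Definition C1_field phi := forall i j : 'I_m,
  (forall x, derivable (fun y => phi y ord0 j : R) x (delta_mx 0 i)) /\
  continuous (partial_deriv i (fun y => phi y ord0 j)).

Definition divergence phi (x : V) : R :=
  \sum_(i < m) partial_deriv i (fun y => phi y ord0 i) x.

Definition test_field Omega : set (V -> V) := [set phi |
  [/\ C1_field phi,
      compact (closure [set x | phi x != 0]),
      closure [set x | phi x != 0] `<=` Omega &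
      forall x, enorm (phi x) <= 1]].

Definition perimeter E Omega : \bar R :=
  ereal_sup [set (\int[leb]_(x in E `&` Omega) (divergence phi x)%:E)%E
            | phi in test_field Omega].

Definition finite_perimeter E Omega :=
  lebesgue_measurable_set (E `&` Omega) /\ (perimeter E Omega < +oo)%E.

Definition CP Omega z1 z2 : set (V -> R) := [set u |
  lebesgue_measurable_fun Omega u /\
  exists E, [/\ finite_perimeter E Omega,
    {ae leb, forall x, (Omega `&` E) x -> u x = z1 x} &
    {ae leb, forall x, (Omega `\` E) x -> u x = z2 x}]].

Definition holder (alpha : R) z :=
  exists C : R, forall x y, `|z x - z y| <= C * enorm (x - y) `^ alpha.

Definition locally_holder2 (alpha : R) (g : V -> R -> R) :=
  forall K : set (V * R), compact K -> exists C : R,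
  forall x t y s, K (x, t) -> K (y, s) ->
    `|g x t - g y s| <= C * Num.sqrt (enorm (x - y) ^+ 2 + (t - s) ^+ 2) `^ alpha.

Definition C2 (g : R -> R) :=
  [/\ forall t, derivable g t 1,
      forall t, derivable (derive1 g) t 1 &
      continuous (derive1 (derive1 g))].

Definition W1 (W : V -> R -> R) z1 z2 :=
  continuous (fun p : V * R => W p.1 p.2) /\
  (forall x, C2 (W x)) /\
  (forall x t, W x t = 0 <-> t = z1 x \/ t = z2 x) /\
  exists2 alpha : R, 2^-1 < alpha <= 1 &
    [/\ locally_holder2 alpha (fun x t => derive1 (W x) t),
        holder alpha z1 & holder alpha z2].

(* A pointwise strict bound: the minimum over a nonempty compact K is attained. *)
Definition W2 z1 z2 (K : set V) (delta : R) :=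
  (forall x, K x -> 8 * delta < `|z1 x - z2 x|) /\
  (forall x, K x -> z1 x < z2 x).

Definition W5 (W : V -> R -> R) (K : set V) (delta : R) :=
  forall x t, K x -> delta^-1 < `|t| -> delta * `|t| <= W x t.

Definition energy Omega J (W : V -> R -> R) (eps : R) u : \bar R :=
  ((4 * eps)^-1%:E *
     \int[leb \x leb]_(p in Omega `*` Omega)
       (eps ^- m * J (eps^-1 *: (p.1 - p.2)) * `|u p.1 - u p.2| ^+ 2)%:E
   + eps^-1%:E * \int[leb]_(x in Omega) (W x (u x))%:E)%E.

Definition in_L1 Omega u :=
  lebesgue_measurable_fun Omega u /\
  (\int[leb]_(x in Omega) `|u x|%:E < +oo)%E.

Definition cvg_L1 Omega (u_ : nat -> V -> R) u :=
  [/\ forall k, in_L1 Omega (u_ k), in_L1 Omega u &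
      (\int[leb]_(x in Omega) `|u_ k x - u x|%:E)%E @[k --> \oo] --> 0%E].

End definitions.

(* Main.v *)
(**
  The nonlocal energy sees the phases E_eps of u_eps (the points where u_eps is
  closer to z1 than to z2) through the set of pairs (x, y) of Omega x Omega with
  (x - y) / eps in a bounded symmetric set A of positive measure on which J is
  bounded below, and E_eps(x) <> E_eps(y): since z2 - z1 is bounded below and
  the potential controls the set of points where u_eps is far from both wells,
  the measure of these pairs is at most C eps^(m+1).  For small h / eps the set
  A overlaps its translate by h / eps in measure, so averaging over the overlap
  bounds the measure of the set where E_eps differs from its translate by h;
  chaining such steps gives, away from the boundary of Omega, the bound
  C (|h| + eps) for every h.  Hence in a fine grid E_eps is, up to a small
  measure, the union of the cubes in which it has the majority; as a grid gives
  finitely many unions, a diagonal argument extracts a limit set E.  It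
  satisfies the translation bound C |h|, so testing with difference quotients
  shows that its perimeter is finite.  The L^1 distance of u_eps to the function
  u equal to z1 on E and to z2 off E is bounded by the integral of the distance
  to the wells, controlled by the potential thanks to its linear growth, and by
  the measure of the symmetric difference of E_eps and E.
*)

Require Import Defs.
From HB Require Import structures.
From mathcomp Require Import all_boot all_order all_algebra.
From mathcomp Require Import all_classical all_reals all_analysis.
From mathcomp Require Import measurable_realfun lra ring.

Set Implicit Arguments.
Unset Strict Implicit.
Unset Printing Implicit Defensive.

Import Order.TTheory GRing.Theory Num.Theory.
Import numFieldNormedType.Exports.

Set SsrOldRewriteGoalsOrder.

Local Open Scope classical_set_scope.
Local Open Scope ring_scope.

(** * Lebesgue measure on row vectors *)

(** The kernel is only known to be non-zero on a set of positive measure, which may lie far from the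
    origin, so the energy need not compare nearby points directly. Small translations are reached
    through a third point: if [k] and [k - h] both lie in [e A], their difference is [h], and such
    [k] abound because translation is continuous in measure, even when [A] has empty interior. After
    rescaling their measure is a fixed multiple of [e ^+ m]; dividing the measure [e ^+ m.+1] of the
    bad pairs by it leaves one factor [e] per step of length [r * e], that is, a cost proportional
    to the length.

    The resulting bound says nothing at scales below [e]. The grid is therefore fixed first, from
    the desired accuracy alone, and the code it defines is used only from some index on.

    [J] and [u_ eps] are Lebesgue measurable, so the integrands of the energy need not be Borel. The
    energy enters only through lower bounds, by constants on Borel sets or by Borel functions, for
    which monotonicity of the integral suffices; Borel representatives agree with the data off a
    null set [N]. *)

Section nonmeasurable_integrands.
Local Open Scope ereal_scope.
Context d (T : measurableType d) (R : realType).
Variable mu : {measure set T -> \bar R}.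

(** For a nonnegative integrand the integral is a supremum over the simple functions below it, and a
    larger integrand admits more of them. *)
Lemma le_integral_nonmeas (D : set T) (f g : T -> \bar R) :
  (forall x, D x -> 0 <= f x) -> (forall x, D x -> f x <= g x) ->
  \int[mu]_(x in D) f x <= \int[mu]_(x in D) g x.
Proof.
move=> f0 fg; rewrite !ge0_integralE//; last first.
  by move=> x Dx; exact: le_trans (f0 _ Dx) (fg _ Dx).
apply: le_ereal_sup => _ [h /= hf <-]; exists h => //= x.
apply: le_trans (hf x) _; rewrite /patch; case: ifPn => // /set_mem Dx.
exact: fg.
Qed.

Lemma le_measure_integral (D A : set T) (c : R) (f : T -> \bar R) :
  measurable D -> measurable A -> A `<=` D -> (0 <= c)%R ->
  (forall x, D x -> 0 <= f x) -> (forall x, A x -> c%:E <= f x) ->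
  c%:E * mu A <= \int[mu]_(x in D) f x.
Proof.
move=> mD mA AD c0 f0 cf.
rewrite -(setIidr AD) setIC -integral_indic// -ge0_integralZl//; last first.
  exact/measurable_EFinP/measurable_indic.
apply: le_integral_nonmeas => x Dx; first by rewrite -EFinM lee_fin mulr_ge0.
rewrite indicE; case: (boolP (x \in A)) => [/set_mem Ax|_].
  by rewrite mule1; exact: cf.
by rewrite mule0 f0.
Qed.

End nonmeasurable_integrands.

(** * Borel sets and measurable maps of row vectors *)

Section rV_borel.
Context {R : realType} (m : nat).
Local Notation V := 'rV[R]_m.
Implicit Types (x y h : V) (A B : set V).

Lemma rV_normP x (e : R) : 0 <= e -> (`|x| <= e) <-> (forall i, `|x ord0 i| <= e).
Proof.
move=> e0; split.
  move=> xe i; apply: le_trans xe.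
  rewrite [leRHS]/Num.norm /= mx_normrE; apply/bigmax_geP; right => /=.
  by exists (ord0, i).
move=> xe; rewrite /Num.norm/= mx_normrE; apply/bigmax_leP; split => // -[j i] _ /=.
by rewrite ord1.
Qed.

Lemma rV_norm_coord x i : `|x ord0 i| <= `|x|.
Proof. by move: i; apply/rV_normP. Qed.

Lemma measurable_rV_setI (A : 'I_m -> set (measurableTypeR R)) :
  (forall i, measurable (A i)) -> measurable [set x : V | forall i, A i (x ord0 i)].
Proof.
move=> mA; rewrite (_ : [set _ | _] =
    \bigcap_(i in [set: 'I_m]) (rV_coord i @^-1` A i)).
  apply: fin_bigcap_measurable => // i _.
  by rewrite -[X in measurable X]setTI; exact: measurable_rV_coord.
by apply/seteqP; split => [x Ax i _|x Ax i]; exact: Ax.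
Qed.

Let rbox (p : 'rV[rat]_m * nat) : set V :=
  [set x | forall i, `]ratr (p.1 ord0 i) - p.2.+1%:R^-1, ratr (p.1 ord0 i) + p.2.+1%:R^-1[%classic (x ord0 i)].

Lemma open_measurable_rV (U : set V) : open U -> measurable U.
Proof.
move=> oU.
(* [F] enumerates the boxes with rational centre and half-side [1/(n+1)] that lie in [U]; all other
   codes give the empty set. *)
pose F n := if unpickle n is Some p then if `[< rbox p `<=` U >] then rbox p else set0 else set0.
have -> : U = \bigcup_n F n.
  apply/seteqP; split => [x Ux|x [n _]]; last first.
    rewrite /F; case: unpickle => // p; case: ifPn => // /asboolP; exact.
  have /nbhs_ballP[e/= e0 xeU] := open_nbhs_nbhs (conj oU Ux).
  have [n ne] : exists n, 2 * n.+1%:R^-1 < e :> R.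
    have [n ne] := ltr_add_invr (divr_gt0 e0 (@ltr0Sn R 1)).
    by exists n; move: ne; rewrite add0r ltr_pdivlMr// mulrC.
  have /choice[q qx] : forall i, exists q : rat, x ord0 i - n.+1%:R^-1 < ratr q < x ord0 i + n.+1%:R^-1.
    move=> i.
    have /rat_in_itvoo[q] : x ord0 i - n.+1%:R^-1 < x ord0 i + n.+1%:R^-1.
      by rewrite -ltrBlDl addrAC subrr sub0r (@lt_trans _ _ 0)// ?oppr_lt0 invr_gt0.
    by rewrite in_itv/=; exists q.
  pose p : 'rV[rat]_m * nat := (\row_i q i, n).
  exists (pickle p) => //; rewrite /F pickleK.
  have px : rbox p x.
    move=> i /=; rewrite in_itv/= mxE.
    by have /andP[? ?] := qx i; apply/andP; split; rewrite ?ltrBlDr// -ltrBlDr.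
  case: asboolP => // -[] y py; apply: xeU.
  split=> // i j; rewrite (_ : i = ord0) /ball/=; last exact: ord1.
  have := px j; have := py j; rewrite /= !in_itv/= !mxE => /andP[y1 y2] /andP[x1 x2].
  apply: lt_trans ne; rewrite ltr_norml.
  by move: (n.+1%:R^-1) (ratr _) (x ord0 j) (y ord0 j) x1 x2 y1 y2 => t r a b x1 x2 y1 y2; apply/andP; split; lra.
apply: bigcupT_measurable => n; rewrite /F; case: unpickle => // p.
by case: ifP => // _; apply: (@measurable_rV_setI (fun i => `]_, _[%classic)) => i.
Qed.

Lemma continuous_measurable_rV (f : V -> R) :
  continuous f -> measurable_fun [set: V] f.
Proof.
move=> cf; apply: (measurability _ (RGenOpens.measurableE R)).
move=> _ [_ [a [b ->] <-]]; rewrite setTI; apply: open_measurable_rV.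
by apply: open_comp => // x _; exact: cf.
Qed.

Lemma measurable_rV_coordT i : measurable_fun [set: V] (fun x : V => x ord0 i).
Proof. exact: measurable_rV_coord. Qed.

Lemma measurable_rV_add d (T : measurableType d) (f g : T -> V) :
  measurable_fun setT f -> measurable_fun setT g ->
  measurable_fun setT (fun x : T => f x + g x).
Proof.
move=> mf mg; apply: measurable_fun_rV => i.
rewrite (_ : _ \o _ = (fun x : T => (rV_coord i \o f) x + (rV_coord i \o g) x)).
  by apply: measurable_funD; apply: measurableT_comp => //; exact: measurable_rV_coord.
by apply/funext => x; rewrite /= /rV_coord mxE.
Qed.

Lemma measurable_rV_scale d (T : measurableType d) (c : R) (f : T -> V) :
  measurable_fun setT f -> measurable_fun setT (fun x : T => c *: f x).
Proof.
move=> mf; apply: measurable_fun_rV => i.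
rewrite (_ : _ \o _ = (fun x : T => c * (rV_coord i \o f) x)).
  by apply: measurable_funM => //; apply: measurableT_comp => //; exact: measurable_rV_coord.
by apply/funext => x; rewrite /= /rV_coord mxE.
Qed.

Lemma measurable_rV_opp d (T : measurableType d) (f : T -> V) :
  measurable_fun setT f -> measurable_fun setT (fun x : T => - f x).
Proof.
move=> mf; under eq_fun do rewrite -scaleN1r.
exact: measurable_rV_scale.
Qed.

Lemma measurable_affine (s : R) (v : V) : measurable_fun setT (fun x : V => s *: x + v).
Proof. by apply: measurable_rV_add => //; exact: measurable_rV_scale. Qed.

Lemma measurable_preimageT d d' (T : measurableType d) (T' : measurableType d')
  (f : T -> T') (B : set T') :
  measurable_fun setT f -> measurable B -> measurable (f @^-1` B).
Proof. by move=> mf mB; rewrite -[X in measurable X]setTI; exact: mf. Qed.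

Lemma measurable_shift v B : measurable B -> measurable [set x | B (x + v)].
Proof.
by move=> mB; apply: (@measurable_preimageT _ _ _ _ (fun x : V => x + v)) => //; exact: measurable_rV_add.
Qed.

End rV_borel.

Arguments measurable_shift {R m} v [B].

(** * Lebesgue measure under dilations and translations *)

Section affine_1d.
Context {R : realType}.
Local Open Scope ereal_scope.

Lemma lebesgue_measure_affine (s a : R) (A : set (measurableTypeR R)) : (0 < s)%R -> measurable A ->
  lebesgue_measure A = s%:E * lebesgue_measure [set t : measurableTypeR R | A (s * t + a)%R].
Proof.
move=> s0 mA.
pose f := fun t : measurableTypeR R => (s * t + a)%R : measurableTypeR R.
have mf : measurable_fun setT f.
  by apply: measurable_funD => //; apply: measurable_funM.
pose nu := mscale (NngNum (ltW s0)) (pushforward lebesgue_measure f).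
have nuE X : nu mf X = s%:E * lebesgue_measure (f @^-1` X) by [].
rewrite -[RHS]nuE.
apply: (@lebesgue_measure_unique _ (nu mf)) => // _ [[b c]] _ <-.
change (lebesgue_measure `]b, c]%classic = s%:E * lebesgue_measure (f @^-1` `]b, c]%classic)).
rewrite (_ : f @^-1` _ = `](b - a) / s, (c - a) / s]%classic)%R; last first.
  apply/seteqP; split => t /=; rewrite !in_itv/= ltr_pdivrMr// ler_pdivlMr// ltrBlDr lerBrDr mulrC//.
rewrite !lebesgue_measure_itv/= !lte_fin ltr_pM2r ?invr_gt0// ltrD2r.
case: ifPn => _; last by rewrite mule0.
by rewrite -!EFinD -EFinM -mulrBl mulrCA divff ?gt_eqF// mulr1; congr (_%:E); ring.
Qed.

End affine_1d.

Section affine.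
Context {R : realType} (m : nat).
Local Notation V := 'rV[R]_m.
Local Notation mu := (lebesgue_rV m : set V -> \bar R).
Local Open Scope ereal_scope.

Let G : set (set V) := [set [set x : V | forall i, A i (x ord0 i)] | A in [set A : 'I_m -> set (measurableTypeR R) | forall i, measurable (A i)]].

Lemma rV_measurableE : (measurable : set (set V)) = <<s G >>.
Proof.
apply/seteqP; split; last first.
  by apply: smallest_sub; [exact: sigma_algebra_measurable|move=> _ [A mA <-]; exact: measurable_rV_setI].
apply: smallest_sub; first exact: smallest_sigma_algebra.
rewrite -bigcup_seq => B [i /= _ [C mC <-]]; apply: sub_sigma_algebra.
exists (fun j => if j == i then C else setT) => [j|]; first by case: ifP.
rewrite setTI; apply/seteqP; split => x /= Cx; first by have := Cx i; rewrite eqxx.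
by move=> j; case: eqP => // ->.
Qed.

Definition rV_cube (a : 'I_m -> R) (s : R) : set V :=
  [set x | forall i, (a i <= x ord0 i < a i + s)%R].

Lemma rV_cubeE a s : rV_cube a s = [set x | forall i, `[a i, a i + s[%classic%R (x ord0 i)].
Proof. by apply/seteqP; split => x /= xQ i; have := xQ i; rewrite in_itv. Qed.

Lemma measurable_rV_cube a s : measurable (rV_cube a s).
Proof.
by rewrite rV_cubeE; apply: (@measurable_rV_setI _ _ (fun i => `[a i, a i + s[%classic%R)).
Qed.

Lemma lebesgue_rV_cube a (s : R) : (0 <= s)%R -> mu (rV_cube a s) = (s ^+ m)%:E.
Proof.
move=> s0; rewrite rV_cubeE (@lebesgue_rV_box _ _ (fun i => `[a i, a i + s[%classic%R))//.
rewrite (eq_bigr (fun=> s%:E)); first by rewrite prodEFin prodr_const card_ord.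
move=> i _; rewrite lebesgue_measure_itv/= lte_fin ltrDl.
case: ltP => [_|s0']; first by rewrite -EFinD addrAC subrr add0r.
by congr (_%:E); apply/le_anti; rewrite s0 s0'.
Qed.

(** The measure is built by recursion on the dimension, so its invariance has to be recovered from
    the product formula on boxes: boxes form a pi-system generating the Borel sets, both sides agree
    on them coordinate by coordinate, and the cubes [g k] of finite measure exhaust the space. *)
Lemma lebesgue_rV_affine (s : R) (v : V) (B : set V) : (0 < s)%R -> measurable B ->
  mu B = (s ^+ m)%:E * mu [set x | B (s *: x + v)%R].
Proof.
move=> s0 mB.
pose f := fun x : V => (s *: x + v)%R.
have mf : measurable_fun setT f by exact: measurable_affine.
pose nu := mscale (NngNum (exprn_ge0 m (ltW s0))) (pushforward (lebesgue_rV m) f).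
have nuE X : nu mf X = (s ^+ m)%:E * mu (f @^-1` X) by [].
rewrite -[RHS]nuE.
pose g (k : nat) : set V := rV_cube (fun=> - k%:R)%R (k%:R + k%:R)%R.
apply: (@measure_unique _ _ _ G g rV_measurableE _ _ _ (lebesgue_rV m) (nu mf)) => //.
- move=> _ _ [A mA <-] [B' mB' <-]; exists (fun i => A i `&` B' i); first by move=> i; exact: measurableI.
  apply/seteqP; split => x /=; first by move=> h; split => i; have [] := h i.
  by move=> [h1 h2] i; split.
- by move=> k; rewrite /g rV_cubeE; exists (fun=> `[- k%:R, - k%:R + (k%:R + k%:R)[%classic)%R.
- rewrite -subTset => x _; exists (Num.truncn `|x|).+1 => // i /=.
  rewrite addrA addNr add0r; apply/andP.
  suff: (`|x ord0 i| < (Num.truncn `|x|).+1%:R)%R by rewrite ltr_norml => /andP[/ltW].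
  by apply: le_lt_trans (rV_norm_coord _ _) _; exact: truncnS_gt.
- move=> _ [A mA <-]; change (mu [set x : V | forall i, A i (x ord0 i)] = (s ^+ m)%:E * mu (f @^-1` [set x : V | forall i, A i (x ord0 i)])).
  rewrite (_ : f @^-1` _ = [set x | forall i, [set t : measurableTypeR R | A i (s * t + v ord0 i)%R] (x ord0 i)]); last first.
    by apply/seteqP; split => x /= h i; have := h i; rewrite !mxE.
  rewrite (lebesgue_rV_box mA) (@lebesgue_rV_box _ _ (fun i => [set t : measurableTypeR R | A i (s * t + v ord0 i)%R])); last first.
    move=> i; apply: (@measurable_preimageT _ _ _ _ (fun t : measurableTypeR R => s * t + v ord0 i : measurableTypeR R)%R) => //.
    by apply: measurable_funD => //; apply: measurable_funM.
  under eq_bigr => i _ do rewrite (lebesgue_measure_affine (v ord0 i) s0 (mA i)).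
  rewrite big_split/=; congr (_ * _).
  by rewrite prodEFin prodr_const card_ord.
- by move=> k; suff : mu (g k) < +oo by []; rewrite lebesgue_rV_cube ?ltry// addr_ge0.
Qed.

Lemma lebesgue_rV_shift (v : V) (B : set V) : measurable B -> mu [set x | B (x + v)%R] = mu B.
Proof.
move=> mB; rewrite (@lebesgue_rV_affine 1 v B)// expr1n mul1e.
by congr mu; apply/funext => x /=; rewrite scale1r.
Qed.

Lemma bounded_measure_lty (B : set V) (M : R) : measurable B ->
  (forall x, B x -> `|x| <= M)%R -> mu B < +oo.
Proof.
move=> mB BM; apply: (@le_lt_trans _ _ (mu (rV_cube (fun=> - (`|M| + 1)) ((`|M| + 1) + (`|M| + 1)))%R)).
  apply: le_measure; rewrite ?inE//; first exact: measurable_rV_cube.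
  move=> x Bx i /=; rewrite addrA addNr add0r; apply/andP.
  suff: (`|x ord0 i| < `|M| + 1)%R by rewrite ltr_norml => /andP[/ltW].
  apply: le_lt_trans (rV_norm_coord _ _) _; apply: le_lt_trans (BM _ Bx) _.
  by apply: le_lt_trans (ler_norm _) _; rewrite ltrDl.
by rewrite lebesgue_rV_cube ?ltry// !addr_ge0.
Qed.

End affine.

Section measure_bounds.
Local Open Scope ereal_scope.
Context d (T : measurableType d) (R : realType).
Variable mu : {measure set T -> \bar R}.

Lemma measure_leU (X A B : set T) (a b : \bar R) :
  measurable X -> measurable A -> measurable B -> X `<=` A `|` B ->
  mu A <= a -> mu B <= b -> mu X <= a + b.
Proof.
move=> mX mA mB XAB Aa Bb; apply: le_trans (leeD Aa Bb).
apply: le_trans (measureU2 mu mA mB).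
by apply: le_measure; rewrite ?inE//; exact: measurableU.
Qed.

Lemma cvge0_le (u : nat -> \bar R) (eta : R) : u n @[n --> \oo] --> 0 -> (0 < eta)%R ->
  exists N, forall n, (N <= n)%N -> u n <= eta%:E.
Proof.
move=> /fine_cvgP[fin /cvgrPdist_lt H] eta0.
have [N _ HN] := filterI fin (H _ eta0).
exists N => n Nn; have [/= fu] := HN _ Nn.
by rewrite sub0r normrN => /ltW/(le_trans (ler_norm _)) ?; rewrite -(fineK fu) lee_fin.
Qed.

Lemma nonincreasing_measure_le (F : (set T)^nat) (eta : R) :
  mu (F 0%N) < +oo -> (forall i, measurable (F i)) -> nonincreasing_seq F ->
  \bigcap_n F n = set0 -> (0 < eta)%R -> exists N, mu (F N) <= eta%:E.
Proof.
move=> F0 mF niF F00 eta0.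
have := nonincreasing_cvg_mu F0 mF (bigcapT_measurable mF) niF.
by rewrite F00 measure0 => /cvge0_le/(_ eta0)[N /(_ _ (leqnn _))]; exists N.
Qed.

Lemma measurable_setY (A B : set T) : measurable A -> measurable B -> measurable (A `+` B).
Proof. by move=> mA mB; apply: measurableU; exact: measurableD. Qed.

End measure_bounds.

(** * The product measure under shears and translations *)

Section product_invariance.
Context {R : realType} (m : nat).
Local Notation V := 'rV[R]_m.
Local Notation mu := (lebesgue_rV m : set V -> \bar R).
Local Notation mu2 := ((lebesgue_rV m \x lebesgue_rV m)%E : set (V * V) -> \bar R).
Local Open Scope ereal_scope.
Implicit Types X : set (V * V).

Lemma measurable_shear X : measurable X -> measurable [set p : V * V | X (p.1, p.2 - p.1)%R].
Proof.
move=> mX; apply: (@measurable_preimageT _ _ _ _ (fun p : V * V => (p.1, p.2 - p.1)%R)) => //.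
apply: measurable_fun_pair => //; apply: measurable_rV_add => //; exact: measurable_rV_opp.
Qed.

Lemma mu2_shear X : measurable X -> mu2 [set p : V * V | X (p.1, p.2 - p.1)%R] = mu2 X.
Proof.
move=> mX; rewrite /= /product_measure1/=; apply: eq_integral => x _ /=.
have -> : xsection [set p : V * V | X (p.1, p.2 - p.1)%R] x = [set y | (xsection X x) (y - x)%R].
  by apply/seteqP; split => y; rewrite /xsection/= !inE.
by rewrite -[RHS](lebesgue_rV_shift (- x)%R)//; exact: measurable_xsection.
Qed.

Lemma mu2_ysection X : measurable X -> mu2 X = \int[mu]_y mu (ysection X y).
Proof.
move=> mX; rewrite -[RHS]/((lebesgue_rV m \x^ lebesgue_rV m)%E X).
apply: product_measure_unique => // A B mA mB.
exact: product_measure2E.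
Qed.

Lemma measurable_shift2 h X : measurable X -> measurable [set p : V * V | X (p.1 + h, p.2)%R].
Proof.
move=> mX; apply: (@measurable_preimageT _ _ _ _ (fun p : V * V => (p.1 + h, p.2)%R)) => //.
by apply: measurable_fun_pair => //; exact: measurable_rV_add.
Qed.

Lemma mu2_shift h X : measurable X -> mu2 [set p : V * V | X (p.1 + h, p.2)%R] = mu2 X.
Proof.
move=> mX; rewrite !mu2_ysection//; last exact: measurable_shift2.
apply: eq_integral => y _.
have -> : ysection [set p : V * V | X (p.1 + h, p.2)%R] y = [set x | (ysection X y) (x + h)%R].
  by apply/seteqP; split => x; rewrite /ysection/= !inE.
by rewrite lebesgue_rV_shift//; exact: measurable_ysection.
Qed.

Lemma mu2_shift_le h X (c : \bar R) : measurable X -> mu2 X <= c ->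
  mu2 [set p : V * V | X (p.1 + h, p.2)%R] <= c.
Proof. by move=> mX; rewrite mu2_shift. Qed.

Lemma measurable_difference (A : set V) : measurable A -> measurable [set p : V * V | A (p.1 - p.2)%R].
Proof.
move=> mA; apply: (@measurable_preimageT _ _ _ _ (fun p : V * V => p.1 - p.2)%R) => //.
apply: measurable_rV_add => //; exact: measurable_rV_opp.
Qed.

(* Fubini with the difference of the two variables as one of the variables. *)
Lemma mu2_difference_le X (H : set V) (c : R) :
  measurable X -> measurable H -> (0 <= c)%R ->
  (forall p, X p -> H (p.2 - p.1)%R) ->
  (forall h, H h -> mu [set x | X (x, x + h)%R] <= c%:E) ->
  mu2 X <= c%:E * mu H.
Proof.
move=> mX mH c0 XH Xc.
pose Y : set (V * V) := [set p | X (p.1, p.1 + p.2)%R].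
have mY : measurable Y.
  apply: (@measurable_preimageT _ _ _ _ (fun p : V * V => (p.1, p.1 + p.2)%R)) => //.
  by apply: measurable_fun_pair => //; exact: measurable_rV_add.
have -> : mu2 X = mu2 Y.
  rewrite -(mu2_shear mY); congr mu2; apply/seteqP; split => -[x y] /=; rewrite /Y/= addrC subrK//.
rewrite mu2_ysection// -(setIT H) -integral_indic// -ge0_integralZl//; last first.
  exact/measurable_EFinP/measurable_indic.
apply: le_integral_nonmeas => // h _.
rewrite indicE; case: (boolP (h \in H)) => [/set_mem Hh|/negP nH].
  rewrite mule1; have := Xc _ Hh; congr (_ <= _); congr mu.
  by apply/seteqP; split => x; rewrite /ysection/= inE.
rewrite mule0 (_ : ysection _ _ = set0) ?measure0//.
apply/seteqP; split => // x; rewrite /ysection/= inE /Y/= => /XH/=.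
by rewrite addrC addKr => ?; apply: nH; rewrite inE.
Qed.

End product_invariance.

(** The measure of this set is the L^1 distance between the indicator of [E] and its translate by
    [h]: its size in [h] measures the regularity of [E]. *)
Definition jump {R : realType} (m : nat) (E : set 'rV[R]_m) (h : 'rV[R]_m) : set 'rV[R]_m :=
  E `+` [set x | E (x + h)].

(** * Overlap of a set with its translates *)

Section jump.
Context {R : realType} (m : nat).
Local Notation V := 'rV[R]_m.
Local Notation mu := (lebesgue_rV m : set V -> \bar R).
Implicit Types (E B : set V) (h x : V).

Lemma jumpP E h x : jump E h x <-> ~ (E x <-> E (x + h)).
Proof.
by rewrite /jump/=; have [e|e] := pselect (E x); have [e'|e'] := pselect (E (x + h)); tauto.
Qed.

Lemma lebesgue_rV_shift_le h B a : measurable B -> (mu B <= a)%E -> (mu [set x | B (x + h)%R] <= a)%E.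
Proof. by move=> mB; rewrite lebesgue_rV_shift. Qed.

Lemma measurable_jump E h : measurable E -> measurable (jump E h).
Proof. by move=> mE; apply: measurable_setY => //; exact: measurable_shift. Qed.

Let Q (M : R) : set V := [set x | `|x| <= M].

Lemma measurable_le_norm M : measurable (Q M).
Proof.
have := @measurable_preimageT _ _ _ _ (fun x : V => `|x|) `]-oo, M]%classic
  (@continuous_measurable_rV R m (fun x : V => `|x|) (@norm_continuous _ _)).
rewrite (_ : _ @^-1` _ = Q M); first exact.
by apply/seteqP; split => x; rewrite /= in_itv.
Qed.

(* Continuity of translations in measure holds for a sigma-algebra of sets which
   contains the half-spaces, hence for all Borel sets. *)
Let D : set (set V) := [set B | measurable B /\
  forall M eta : R, 0 < M -> 0 < eta -> exists2 r : R, 0 < r &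
    forall h, `|h| < r -> (mu (jump B h `&` Q M) <= eta%:E)%E].

Let DU B B' : D B -> D B' -> D (B `|` B').
Proof.
move=> [mB cB] [mB' cB']; split; first exact: measurableU.
move=> M eta M0 eta0; have eta2 : 0 < eta / 2 by rewrite divr_gt0.
have [r r0 Br] := cB _ _ M0 eta2; have [r' r'0 Br'] := cB' _ _ M0 eta2.
exists (Num.min r r'); first by rewrite lt_min r0.
move=> h; rewrite lt_min => /andP[hr hr'].
rewrite [eta]splitr EFinD; apply: (measure_leU _ _ _ _ (Br h hr) (Br' h hr')).
- by apply: measurableI; [by apply: measurable_jump; exact: measurableU|exact: measurable_le_norm].
- by apply: measurableI; [exact: measurable_jump|exact: measurable_le_norm].
- by apply: measurableI; [exact: measurable_jump|exact: measurable_le_norm].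
- move=> x [/jumpP /= xB xM]; have [e|/jumpP e] := pselect (jump B h x); first by left.
  by right; split => //; apply/jumpP => e'; apply: e => ?; apply: xB; tauto.
Qed.

Let DC B : D B -> D (~` B).
Proof.
move=> [mB cB]; split; first exact: measurableC.
move=> M eta M0 eta0; have [r r0 Br] := cB _ _ M0 eta0; exists r => // h /Br.
congr (mu (_ `&` _) <= _)%E; apply/seteqP; split => x /jumpP H; apply/jumpP; move: H => /=; tauto.
Qed.

Let D0 : D set0.
Proof.
split=> // M eta M0 eta0; exists 1 => // h _.
by rewrite (_ : jump _ _ = set0) ?set0I ?measure0 ?lee_fin ?ltW//; apply/seteqP; split => x //= [] [].
Qed.

Let Dsigma : sigma_algebra setT D.
Proof.
split; first exact: D0.
  by move=> B; rewrite setTD; exact: DC.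
move=> F DF; pose U := \bigcup_k F k; pose Un n := \big[setU/set0]_(i < n) F i.
have DUn n : D (Un n).
  rewrite /Un; elim: n => [|n IH]; first by rewrite big_ord0; exact: D0.
  by rewrite big_ord_recr /=; exact: DU.
have mU : measurable U by apply: bigcupT_measurable => k; exact: (DF k).1.
split=> // M eta M0 eta0.
have eta3 : 0 < eta / 3 by rewrite divr_gt0.
(* Inside the ball, a jump of the union that is not a jump of [Un n] has [x] or [x + h] in [G n].
   The radius [M + 1] leaves room for [x + h] with [|h| < 1]. *)
pose G n := Q (M + 1) `&` (U `\` Un n).
have mG n : measurable (G n).
  by apply: measurableI; [exact: measurable_le_norm|apply: measurableD => //; exact: (DUn n).1].
have [n Gn] : exists n, (mu (G n) <= (eta / 3)%:E)%E.
  apply: nonincreasing_measure_le => //.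
  - by apply: (@bounded_measure_lty _ _ _ (M + 1)) => // x [].
  - move=> i j ij; apply/subsetPset => x [Qx [Ux nx]]; split => //; split => //.
    apply: contra_not nx; rewrite /Un -!bigcup_mkord => -[k /= ki Fk].
    by exists k => //=; exact: leq_trans ki ij.
  - apply/seteqP; split => // x Gx; have [_ [[k _ Fk] _]] := Gx 0%N I.
    have [_ [_]] := Gx k.+1 I; apply; rewrite /Un -bigcup_mkord; by exists k => /=.
have [r r0 Ur] := (DUn n).2 _ _ M0 eta3.
exists (Num.min r 1); first by rewrite lt_min r0 ltr01.
move=> h; rewrite lt_min => /andP[hr h1].
have UnU x : Un n x -> U x by rewrite /Un -bigcup_mkord => -[k _ Fk]; exists k.
have -> : eta = eta / 3 + (eta / 3 + eta / 3) by field.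
rewrite !EFinD; apply: (@measure_leU _ _ _ _ _ (jump (Un n) h `&` Q M) (G n `|` [set x | G n (x + h)])).
- by apply: measurableI; [exact: measurable_jump|exact: measurable_le_norm].
- by apply: measurableI; [apply: measurable_jump; exact: (DUn n).1|exact: measurable_le_norm].
- by apply: measurableU => //; exact: measurable_shift.
- move=> x [/jumpP xU /= xM].
  have xhM : `|x + h| <= M + 1 by apply: le_trans (ler_normD _ _) _; rewrite lerD// ltW.
  have xM1 : `|x| <= M + 1 by rewrite (le_trans xM)// lerDl.
  have [xUn|xUn] := pselect (Un n x); have [yUn|yUn] := pselect (Un n (x + h)).
  + by have := UnU _ xUn; have := UnU _ yUn; tauto.
  + by left; split => //; apply/jumpP; tauto.
  + by left; split => //; apply/jumpP; tauto.
  + right; have [xx|xx] := pselect (U x); first by left.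
    by right; split => //=; split => //; apply: contrapT; tauto.
- exact: Ur.
- apply: (@measure_leU _ _ _ _ _ (G n) [set x | G n (x + h)]) => //.
  + by apply: measurableU => //; exact: measurable_shift.
  + exact: measurable_shift.
  + exact: lebesgue_rV_shift_le.
Qed.

Let Dcoord (i : 'I_m) (C : set (measurableTypeR R)) : measurable C -> D [set x | C (x ord0 i)].
Proof.
pose Di := [set C : set (measurableTypeR R) | D [set x | C (x ord0 i)]].
move: C; suff : (measurable : set (set (measurableTypeR R))) `<=` Di by move=> + C mC; exact.
have [_ sC sU] := Dsigma.
rewrite RGenOInfty.measurableE; apply: smallest_sub; first split.
- exact: D0.
- by move=> C /sC; rewrite !setTD.
- move=> F DF; exact: (sU (fun k => [set x : V | F k (x ord0 i)])).
move=> _ [a ->]; pose E := [set x : V | `]a, +oo[%classic (x ord0 i)]; suff : D E by [].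
have mE : measurable E.
  apply: (@measurable_preimageT _ _ _ _ (fun x : V => x ord0 i)) => //.
  exact: measurable_rV_coordT.
split=> // M eta M0 eta0.
(* A half-space jumps only within distance [r] of its hyperplane. That slab, cut to the ball, has
   measure at most [2 * r * K], which is below [eta] for the [r] chosen next. *)
pose K := \prod_(j < m | j != i) (M + M).
have K0 : 0 <= K by apply: prodr_ge0 => j _; rewrite addr_ge0// ltW.
exists (eta / (2 * (K + 1))); first by rewrite divr_gt0// mulr_gt0// ltr_wpDl.
move=> h; set r := eta / _ => hr.
have r0 : 0 < r by rewrite (le_lt_trans _ hr).
pose B j := if j == i then `[a - r, a + r]%classic else `[- M, M]%classic.
have mB j : measurable (B j : set (measurableTypeR R)) by rewrite /B; case: ifP.
apply: (@le_trans _ _ (mu [set x : V | forall j, B j (x ord0 j)])).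
  apply: le_measure; rewrite ?inE.
  - by apply: measurableI; [exact: measurable_jump|exact: measurable_le_norm].
  - exact: measurable_rV_setI.
  move=> x [/jumpP xE /= xM] j; have xj := rV_norm_coord x j.
  rewrite /B; case: eqP => [->|_]; rewrite /= in_itv/=; last first.
    by rewrite -ler_norml (le_trans xj).
  have := le_lt_trans (rV_norm_coord h i) hr; rewrite ltr_norml => /andP[h1 h2].
  move: xE; rewrite /E /= !in_itv/= !andbT !mxE.
  move: (x ord0 i) (h ord0 i) h1 h2 => t u h1 h2.
  have [ta|ta] := ltP a t; have [tu|tu] := ltP a (t + u) => // xE; apply/andP; split; try lra; exfalso; exact: xE.
rewrite lebesgue_rV_box// (bigD1 i)//= (eq_bigr (fun=> (M + M)%:E)); last first.
  by move=> j ji; rewrite /B (negbTE ji) lebesgue_measure_itv/= lte_fin gtrN// -EFinB opprK.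
rewrite prodEFin /B eqxx lebesgue_measure_itv/= lte_fin ltrD2l gtrN// -/K.
have r2 : a + r - (a - r) = 2 * r by ring.
rewrite -EFinB -EFinM lee_fin r2.
have <- : r * (2 * (K + 1)) = eta by rewrite /r mulfVK// gt_eqF// mulr_gt0// ltr_wpDl.
by rewrite [2 * r]mulrC -mulrA !ler_pM2l// lerDl.
Qed.

Let measurable_D : (measurable : set (set V)) `<=` D.
Proof.
apply: smallest_sub; first exact: Dsigma.
by rewrite -bigcup_seq => _ [i /= _ [C mC <-]]; rewrite setTI; exact: Dcoord.
Qed.

Lemma jump_small B (K eta : R) : measurable B -> (forall x, B x -> `|x| <= K) ->
  0 < eta -> exists2 r : R, 0 < r & forall h, `|h| < r -> (mu (jump B h) <= eta%:E)%E.
Proof.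
move=> mB BK eta0; have [_ cB] := measurable_D mB.
have K1 : 0 < `|K| + 1 by rewrite ltr_wpDl.
have [r r0 Br] := cB _ _ K1 eta0.
(* A point of the jump has [x] or [x + h] in [B], so for [|h| < 1] it lies in the ball of radius
   [|K| + 1] and the truncation loses nothing. *)
exists (Num.min r 1); first by rewrite lt_min r0 ltr01.
move=> h; rewrite lt_min => /andP[hr h1]; have := Br _ hr; rewrite setIidl// => x.
have KK : K <= `|K| by exact: ler_norm.
move=> [[Bx _]|[/= Bx _]]; rewrite /Q/=; first by rewrite (le_trans (BK _ Bx))// (le_trans KK)// lerDl.
rewrite -(addrK h x); apply: le_trans (ler_normB _ _) _.
by apply: lerD; [exact: le_trans (BK _ Bx) _|exact: ltW].
Qed.

(** A point of [B] that the translation takes out of [B] belongs to the jump. For small [h] such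
    points use up at most half of [mu B], and the other half is the overlap. *)
Lemma overlap_shift B (K : R) : measurable B -> (forall x, B x -> `|x| <= K) ->
  (0 < mu B)%E -> exists2 a : R, 0 < a & exists2 r : R, 0 < r &
  forall h, `|h| < r -> (a%:E <= mu (B `&` [set x | B (x + h)%R]))%E.
Proof.
move=> mB BK B0.
have Bfin : mu B \is a fin_num by rewrite ge0_fin_numE//; exact: bounded_measure_lty BK.
have b0 : 0 < fine (mu B) by rewrite fine_gt0// B0 -ge0_fin_numE.
pose a := fine (mu B) / 2; have a0 : 0 < a by rewrite divr_gt0.
exists a => //; have [r r0 Br] := jump_small mB BK a0; exists r => // h /Br hE.
have mI : measurable (B `&` [set x | B (x + h)%R]).
  by apply: measurableI => //; exact: measurable_shift.
have := @measure_leU _ _ _ (lebesgue_rV m) _ _ _ _ _ mB mI (measurable_jump h mB) _ (lexx _) hE.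
have sub : B `<=` B `&` [set x | B (x + h)] `|` jump B h.
  by move=> x Bx; have [?|?] := pselect (B (x + h)); [left|right; left].
move=> /(_ sub).
have BE : mu B = (a + a)%:E by rewrite /a -splitr fineK.
rewrite -[leLHS]/(mu B) BE => {}H.
by rewrite -(@leeD2rE _ a%:E) -?EFinD.
Qed.

(** The point is uniformity: [a] and [r] do not depend on the scale [e]. *)
Lemma overlap_shift_scaled B (K : R) : measurable B -> (forall x, B x -> `|x| <= K) ->
  (0 < mu B)%E -> exists2 a : R, 0 < a & exists2 r : R, 0 < r &
  forall e h, 0 < e -> `|h| < r * e ->
  ((e ^+ m * a)%:E <= mu [set x | B (e^-1 *: x) /\ B (e^-1 *: (x - h))%R])%E.
Proof.
move=> mB BK B0; have [a a0 [r r0 H]] := overlap_shift mB BK B0.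
exists a => //; exists r => // e h e0 hr.
have mI : measurable (B `&` [set x | B (x - e^-1 *: h)%R]).
  by apply: measurableI => //; exact: measurable_shift.
pose C : set V := [set x | B (e^-1 *: x) /\ B (e^-1 *: (x - h))].
have mC : measurable C.
  rewrite (_ : C = (fun x => e^-1 *: x) @^-1` (B `&` [set x | B (x - e^-1 *: h)])).
    by apply: measurable_preimageT => //; exact: measurable_rV_scale.
  by apply/seteqP; split => x; rewrite /C/= scalerBr.
rewrite -/C (lebesgue_rV_affine 0 e0 mC) EFinM lee_pmul2l//; last by rewrite lte_fin exprn_gt0.
rewrite (_ : [set x | C _] = B `&` [set x | B (x - e^-1 *: h)]); last first.
  by apply/seteqP; split => x; rewrite /C/= addr0 scalerBr scalerA mulVf ?gt_eqF// scale1r.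
apply: H; rewrite normrN normrZ gtr0_norm ?invr_gt0//.
by rewrite ltr_pdivrMl// mulrC.
Qed.

End jump.

(** * Translation estimates *)

Section jump_estimates.
Context {R : realType} (m : nat).
Local Notation V := 'rV[R]_m.
Local Notation mu := (lebesgue_rV m : set V -> \bar R).
Local Notation mu2 := ((lebesgue_rV m \x lebesgue_rV m)%E : set (V * V) -> \bar R).
Implicit Types (E A Omega : set V) (h x : V).

Definition inner Omega (d : R) : set V := [set x | forall h, `|h| < d -> Omega (x + h)].

Lemma innerW Omega d x : 0 < d -> inner Omega d x -> Omega x.
Proof. by move=> d0 /(_ 0); rewrite normr0 addr0; exact. Qed.

Lemma inner_shift Omega d d' x h : `|h| + d' <= d -> inner Omega d x -> inner Omega d' (x + h).
Proof.
move=> hd xd k kd; rewrite -addrA; apply: xd.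
by apply: le_lt_trans (ler_normD _ _) _; apply: lt_le_trans hd; rewrite ltrD2l.
Qed.

Lemma inner_le Omega d d' : d' <= d -> inner Omega d `<=` inner Omega d'.
Proof. by move=> dd x xd h hd; apply: xd; exact: lt_le_trans hd dd. Qed.

(** The strict inequality in [inner] makes its complement a union of open balls centred off [Omega],
    whatever the set [Omega]. *)
Lemma measurable_inner Omega d : measurable (inner Omega d).
Proof.
rewrite -[X in measurable X]setCK; apply: measurableC; apply: open_measurable_rV.
have -> : ~` inner Omega d = \bigcup_(y in ~` Omega) ball y d.
  apply/seteqP; split=> [x /existsNP[h /not_implyP[hd nO]]|x [y /= nO yx] xd].
    by exists (x + h) => //; rewrite -ball_normE /ball_/= addrAC subrr add0r.
  apply: nO; rewrite -(subrKC x y); apply: xd.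
  by move: yx; rewrite -ball_normE.
by apply: bigcup_open => y _; exact: ball_open.
Qed.

Definition pairs Omega A (e : R) E : set (V * V) :=
  [set p | [/\ Omega p.1, Omega p.2, A (e^-1 *: (p.1 - p.2)) & ~ (E p.1 <-> E p.2)]].

Lemma measurable_separated E : measurable E -> measurable [set p : V * V | ~ (E p.1 <-> E p.2)].
Proof.
move=> mE.
rewrite (_ : [set p | _] = (E `*` ~` E) `|` (~` E `*` E)).
  by apply: measurableU; apply: measurableX => //; exact: measurableC.
by apply/seteqP; split => -[x y] /=; have [?|?] := pselect (E x); have [?|?] := pselect (E y); tauto.
Qed.

Lemma measurable_pairs Omega A e E : measurable Omega -> measurable A -> measurable E ->
  measurable (pairs Omega A e E).
Proof.
move=> mO mA mE.
have mA' : measurable [set x | A (e^-1 *: x)].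
  by apply: (@measurable_preimageT _ _ _ _ (fun x : V => e^-1 *: x)) => //; exact: measurable_rV_scale.
rewrite (_ : pairs _ _ _ _ = (Omega `*` Omega) `&` [set p : V * V | A (e^-1 *: (p.1 - p.2))] `&` [set p | ~ (E p.1 <-> E p.2)]).
  apply: measurableI; last exact: measurable_separated.
  by apply: measurableI; [exact: measurableX|exact: (measurable_difference mA')].
by apply/seteqP; split => [p [? ? ? ?]|p [[[? ?] ?] ?]]; split.
Qed.

Section fixed_kernel.
Variables (Omega A : set V) (K : R).
Hypotheses (mO : measurable Omega) (mA : measurable A) (AK : forall x, A x -> `|x| <= K)
  (AN : forall x, A x -> A (- x)) (A0 : (0 < mu A)%E).

(* If k and k - h both lie in e A, then E changes between x and x + k or
   between x + h and x + k whenever it changes between x and x + h. *)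
Lemma jump_step : exists c r L : R, [/\ 0 < c, 0 < r, 0 < L &
  forall (e C d : R) E h, 0 < e -> measurable E ->
  (mu2 (pairs Omega A e E) <= (C * e ^+ m.+1)%:E)%E -> L * e <= d -> `|h| < r * e ->
  (mu (inner Omega d `&` jump E h) <= (c * C * e)%:E)%E].
Proof.
have [a a0 [r r0 H]] := overlap_shift_scaled mA AK A0.
(* The numerator 2 counts the two families of bad pairs that cover the set below, and [a] is the
   overlap per [e ^+ m]. With this [L], both [h] and all vectors of [e A] are shorter than [d], so
   every point involved stays in [Omega]. *)
exists (2 / a), r, (`|K| + r); split=> //.
- by rewrite divr_gt0.
- by rewrite ltr_wpDl.
move=> e C d E h e0 mE EC Ld hr.
have em : 0 < e ^+ m by rewrite exprn_gt0.
set S := inner Omega d `&` jump E h.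
have mS : measurable S by apply: measurableI; [exact: measurable_inner|exact: measurable_jump].
pose B : set V := [set k | A (e^-1 *: k) /\ A (e^-1 *: (k - h))].
have mB : measurable B.
  apply: measurableI; first by apply: (@measurable_preimageT _ _ _ _ (fun x : V => e^-1 *: x)) => //; exact: measurable_rV_scale.
  apply: (@measurable_preimageT _ _ _ _ (fun x : V => e^-1 *: (x - h))) => //.
  by apply: measurable_rV_scale; exact: measurable_rV_add.
have Bh : ((e ^+ m * a)%:E <= mu B)%E by exact: H.
have mSB : measurable (S `*` B) by exact: measurableX.
have mP : measurable (pairs Omega A e E) by exact: measurable_pairs.
have : (mu2 (S `*` B) <= (C * e ^+ m.+1)%:E + (C * e ^+ m.+1)%:E)%E.
  rewrite -(mu2_shear mSB).
  apply: (@measure_leU _ _ _ _ _ (pairs Omega A e E) [set p | pairs Omega A e E (p.1 + h, p.2)]) => //.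
  - exact: measurable_shear.
  - exact: measurable_shift2.
  - move=> [x y]; rewrite /S/B/= => -[[xd /jumpP Eh] [Ak Akh]].
    have Ox : Omega x by apply: (innerW _ xd); apply: lt_le_trans Ld; rewrite mulr_gt0// ltr_wpDl.
    have Oxh : Omega (x + h).
      by apply: xd; apply: lt_le_trans hr _; apply: le_trans Ld; rewrite ler_pM2r// lerDr.
    have Oy : Omega y.
      rewrite -(subrKC x y); apply: xd.
      have : `|y - x| <= K * e.
        by have := AK Ak; rewrite normrZ gtr0_norm ?invr_gt0// ler_pdivrMl// mulrC.
      move=> /le_lt_trans; apply; apply: lt_le_trans Ld; rewrite ltr_pM2r//.
      by apply: le_lt_trans (ler_norm _) _; rewrite ltrDl.
    have {}Ak : A (e^-1 *: (x - y)) by rewrite -opprB scalerN; exact: AN.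
    have {}Akh : A (e^-1 *: (x + h - y)).
      by have := AN Akh; rewrite -scalerN !opprB addrA [h + x]addrC.
    have [xy|xy] := pselect (E x <-> E y); last by left; split.
    by right; split => //=; tauto.
  - exact: mu2_shift_le.
rewrite product_measure1E// -EFinD => {}H.
have : (mu S * (e ^+ m * a)%:E <= (C * e ^+ m.+1 + C * e ^+ m.+1)%:E)%E.
  by apply: le_trans H; rewrite lee_wpmul2l.
rewrite -lee_pdivlMr ?mulr_gt0// => /le_trans; apply.
rewrite -EFinM lee_fin exprS le_eqVlt; apply/orP; left; apply/eqP; field.
by rewrite !gt_eqF.
Qed.

(** [h] is cut into [N] equal steps shorter than [r * e], each costing [c * C * e]. Since [N] is at
    most [|h| / (r * e) + 1], the total is linear in [|h|], and rounding up costs one more step,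
    whence the term [e]. The margin [d + d] leaves a margin [d] around every intermediate point. *)
Lemma jump_chain : exists c L : R, [/\ 0 < c, 0 < L &
  forall (e C d : R) E h, 0 < e -> 0 <= C -> measurable E ->
  (mu2 (pairs Omega A e E) <= (C * e ^+ m.+1)%:E)%E -> L * e <= d -> `|h| <= d ->
  (mu (inner Omega (d + d) `&` jump E h) <= (c * C * (`|h| + e))%:E)%E].
Proof.
have [c [r [L [c0 r0 L0 H]]]] := jump_step.
exists (c * (r^-1 + 1)), L; split => //.
  by rewrite mulr_gt0// addr_gt0// invr_gt0.
move=> e C d E h e0 C0 mE EC Ld hd.
pose N := (Num.truncn (`|h| / (r * e))).+1.
have N0 : 0 < N%:R :> R by rewrite ltr0n.
pose g := N%:R^-1 *: h.
have gr : `|g| < r * e.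
  rewrite normrZ gtr0_norm ?invr_gt0// ltr_pdivrMl// mulrC -ltr_pdivrMl ?mulr_gt0// mulrC.
  exact: truncnS_gt.
have step j : (j <= N)%N ->
    (mu (inner Omega (d + d) `&` jump E (j%:R *: g)) <= (j%:R * (c * C * e))%:E)%E.
  elim: j => [_|j IH jN].
    rewrite scale0r mul0r (_ : _ `&` _ = set0) ?measure0//.
    by apply/seteqP; split=> // x [_ /jumpP]; rewrite addr0; tauto.
  have jg : `|j%:R *: g| <= d.
    apply: le_trans hd; rewrite scalerA normrZ ler_piMl// ger0_norm; last by rewrite divr_ge0.
    by rewrite ler_pdivrMr// mul1r ler_nat ltnW.
  rewrite -natr1 mulrDl mul1r EFinD.
  apply: (@measure_leU _ _ _ _ _ (inner Omega (d + d) `&` jump E (j%:R *: g))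
     [set x | (inner Omega d `&` jump E g) (x + j%:R *: g)]).
  - by apply: measurableI; [exact: measurable_inner|exact: measurable_jump].
  - by apply: measurableI; [exact: measurable_inner|exact: measurable_jump].
  - by apply: measurable_shift; apply: measurableI; [exact: measurable_inner|exact: measurable_jump].
  - move=> x [xd /jumpP xE].
    have [e1|e1] := pselect (E x <-> E (x + j%:R *: g)); last first.
      by left; split => //; apply/jumpP.
    right; split; first by apply: inner_shift xd; rewrite lerD2r.
    by apply/jumpP; move: xE; rewrite scalerDl scale1r addrA; tauto.
  - exact: IH (ltnW jN).
  - apply: lebesgue_rV_shift_le; last exact: H.
    by apply: measurableI; [exact: measurable_inner|exact: measurable_jump].
have := step _ (leqnn N).
rewrite scalerA divff ?gt_eqF// scale1r => /le_trans; apply; rewrite lee_fin.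
have NE : N%:R <= `|h| / (r * e) + 1.
  rewrite /N -natr1 lerD2r truncn_le//.
  by rewrite divr_ge0// mulr_ge0// ltW.
apply: (@le_trans _ _ ((`|h| / (r * e) + 1) * (c * C * e))).
  by rewrite ler_wpM2r// !mulr_ge0// ltW.
have -> : (`|h| / (r * e) + 1) * (c * C * e) = c * C * (r^-1 * `|h| + e).
  by field; rewrite !gt_eqF.
rewrite -subr_ge0 (_ : _ - _ = c * C * (`|h| + r^-1 * e)); last by ring.
by rewrite !mulr_ge0// ?addr_ge0// ?mulr_ge0// ?invr_ge0 ltW.
Qed.

End fixed_kernel.
End jump_estimates.

(** * Compactness *)

(** For each [k] some code is shared by infinitely many indices of any given infinite set. This
    yields decreasing infinite sets, the one obtained at stage [k] being homogeneous for [P k], and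
    [sigma] picks one index from each. *)
Lemma diagonal_pigeonhole (P : nat -> nat -> nat -> Prop) :
  (forall k, exists (T : finType) (c : nat -> T) (N : nat),
    forall i j, (N <= i)%N -> (N <= j)%N -> c i = c j -> P k i j) ->
  exists2 sigma : nat -> nat, {homo sigma : i j / (i < j)%N} &
  forall k i j, (k <= i)%N -> (k <= j)%N -> P k (sigma i) (sigma j).
Proof.
move=> HP; pose inf (S : set nat) := forall n, exists2 i, (n <= i)%N & S i.
have refine k (S : set nat) : inf S -> exists S' : set nat,
    [/\ inf S', S' `<=` S & forall i j, S' i -> S' j -> P k i j].
  move=> iS; have [T [c [N H]]] := HP k.
  (* Otherwise every code has a bound beyond which no index of [S] carries it, and an index of [S]
     above these finitely many bounds is contradictory. *)
  have [t it] : exists t, inf (S `&` [set i | c i = t /\ (N <= i)%N]).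
    apply: contrapT => /forallNP nt.
    have /choice[f fP] : forall t, exists n, forall i, (n <= i)%N -> ~ (S i /\ (c i = t /\ (N <= i)%N)).
      move=> t; have /existsNP[n nn] := nt t; exists n => i ni SN; apply: nn.
      by exists i.
    have [i ni Si] := iS (maxn N (\max_t f t)).
    move: ni; rewrite geq_max => /andP[Ni /bigmax_leqP fi].
    exact: (fP (c i) i (fi _ isT)).
  exists (S `&` [set i | c i = t /\ (N <= i)%N]); split => //.
  by move=> i j [_ [ci Ni]] [_ [cj Nj]]; apply: H => //; rewrite ci.
pose I := {S : set nat | inf S}.
have /choice[f fP] : forall kS : nat * I, exists S' : I,
    sval S' `<=` sval kS.2 /\ forall i j, sval S' i -> sval S' j -> P kS.1 i j.
  move=> [k [S iS]]; have [S' [iS' SS' PS']] := refine k S iS.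
  by exists (exist inf S' iS').
have /choice[g gP] : forall Sn : I * nat, exists i, (Sn.2 <= i)%N /\ sval Sn.1 i.
  by move=> [[S iS] n]; have [i ni Si] := iS n; exists i.
have infT : inf setT by move=> n; exists n.
(* [Sk 0] is unconstrained and [Sk k.+1] is refined for [P k]. Hence [sigma k] is taken from
   [Sk k.+1], so that [P k] already holds from index [k] on. *)
pose Sk := fix Sk k := if k is k'.+1 then f (k', Sk k') else exist inf setT infT.
pose sigma := fix s k := if k is k'.+1 then g (Sk k.+1, (s k').+1) else g (Sk 1%N, 0%N).
have sS k : sval (Sk k.+1) (sigma k) by case: k => [|k]; exact: (gP _).2.
have Sle k i : (k <= i)%N -> sval (Sk i) `<=` sval (Sk k).
  move=> /subnK <-; elim: (i - k)%N => // n IH; apply: subset_trans IH.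
  exact: (fP (_, _)).1.
exists sigma; first by apply: homo_ltn => [|k]; [exact: ltn_trans|exact: (gP (Sk k.+2, (sigma k).+1)).1].
move=> k i j ki kj; apply: (fP (k, Sk k)).2.
  exact: (Sle k.+1 i.+1).
exact: (Sle k.+1 j.+1).
Qed.

Lemma ge_half {R : realType} (a b : \bar R) (t : R) : (a + b = t%:E -> a <= b -> (t / 2)%:E <= b)%E.
Proof.
case: a b => [a| |] [b| |]//; rewrite -EFinD => -[<-]; rewrite !lee_fin => ab.
by rewrite ler_pdivrMr// mulr_natr mulr2n lerD2r.
Qed.

Section compactness.
Context {R : realType} (m : nat).
Local Notation V := 'rV[R]_m.
Local Notation mu := (lebesgue_rV m : set V -> \bar R).
Local Notation mu2 := ((lebesgue_rV m \x lebesgue_rV m)%E : set (V * V) -> \bar R).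

(** The sets [inner Omega (1/(k+1))] exhaust the open set [Omega], and boundedness gives the finite
    measure needed for continuity from above. *)
Lemma measure_setD_inner (Omega : set V) (M eta : R) : open Omega -> (forall x, Omega x -> `|x| <= M) ->
  0 < eta -> exists2 d : R, 0 < d & (mu (Omega `\` inner Omega d) <= eta%:E)%E.
Proof.
move=> oO OM eta0.
have mO := open_measurable_rV oO.
pose F (k : nat) := Omega `\` inner Omega k.+1%:R^-1.
have mF k : measurable (F k) by apply: measurableD => //; exact: measurable_inner.
have [N FN] : exists N, (mu (F N) <= eta%:E)%E.
  apply: nonincreasing_measure_le => //.
  - by apply: (@bounded_measure_lty _ _ _ M) => // x [/OM].
  - move=> i j ij; apply/subsetPset => x [Ox nx]; split => //; apply: contra_not nx.
    by apply: inner_le; rewrite lef_pV2 ?posrE// ler_nat.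
  - apply/seteqP; split => // x Fx; have [Ox _] := Fx 0%N I.
    have /nbhs_ballP[e/= e0 xeO] := open_nbhs_nbhs (conj oO Ox).
    have [n ne] := ltr_add_invr e0; rewrite add0r in ne.
    have [_] := Fx n I; apply => h hn; apply: xeO; rewrite -ball_normE/= opprD addrA subrr add0r normrN.
    exact: lt_trans ne.
by exists N.+1%:R^-1.
Qed.

Variables (Omega : set V) (M C : R) (E_ : nat -> set V) (e_ : nat -> R).
Hypotheses (oO : open Omega) (OM : forall x, Omega x -> `|x| <= M).
Hypotheses (mE : forall n, measurable (E_ n)) (EO : forall n, E_ n `<=` Omega).
Hypotheses (C0 : 0 < C) (e_cvg : e_ n @[n --> \oo] --> (0 : R)).
Hypothesis jump_le : forall d : R, 0 < d -> exists N, forall n (h : V), (N <= n)%N -> `|h| <= d ->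
  (mu (inner Omega (d + d) `&` jump (E_ n) h) <= (C * (`|h| + e_ n))%:E)%E.

Let e_small s : 0 < s -> exists N, forall n, (N <= n)%N -> e_ n <= s.
Proof.
move=> s0; have /cvgrPdist_lt/(_ _ s0)[N _ H] := e_cvg; exists N => n /H /=.
by rewrite sub0r normrN => /ltW/(le_trans (ler_norm _)).
Qed.

Let X s d n : set (V * V) :=
  [set p | [/\ inner Omega d p.1, rV_cube (fun=> - s) (s + s) (p.2 - p.1) & ~ (E_ n p.1 <-> E_ n p.2)]].

Let mX s d n : measurable (X s d n).
Proof.
have mQ : measurable [set p : V * V | rV_cube (fun=> - s) (s + s) (p.2 - p.1)].
  have mQ1 : measurable [set x : V | rV_cube (fun=> - s) (s + s) (- x)].
    apply: (@measurable_preimageT _ _ _ _ (fun x : V => - x)) => //; last exact: measurable_rV_cube.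
    exact: measurable_rV_opp.
  rewrite (_ : [set p | _] = [set p : V * V | [set x : V | rV_cube (fun=> - s) (s + s) (- x)] (p.1 - p.2)]).
    exact: measurable_difference.
  by apply/seteqP; split => p /=; rewrite opprB.
rewrite (_ : X _ _ _ = (inner Omega d `*` setT) `&` [set p : V * V | rV_cube (fun=> - s) (s + s) (p.2 - p.1)] `&` [set p | ~ (E_ n p.1 <-> E_ n p.2)]).
  apply: measurableI; last exact: measurable_separated.
  by apply: measurableI => //; apply: measurableX => //; exact: measurable_inner.
by apply/seteqP; split => [p [? ? ?]|p [[[? ?] ?] ?]]; split.
Qed.

(** The points that see, within sup-distance [s], an amount of the other phase at least half the
    volume of a grid cube of side [s]. *)
Let B s d n : set V := [set x | ((s ^+ m / 2)%:E <= mu (xsection (X s d n) x))%E].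

Let mB s d n : measurable (B s d n).
Proof.
have := measurable_fun_xsection (lebesgue_rV m) (mX s d n).
move=> /(_ measurableT _ (emeasurable_itv `[(s ^+ m / 2)%:E, +oo[)).
rewrite setTI; congr measurable; apply/seteqP; split => x /=; rewrite in_itv/= andbT//.
Qed.

(** Markov's inequality in [x] bounds [s ^+ m / 2] times the measure of [B] by that of [X], and
    Fubini in the difference variable bounds the latter by [C * (s + s)] times the volume
    [(s + s) ^+ m] of admissible differences. The quotient of [(s + s) ^+ m] by [s ^+ m / 2] is
    [2 ^+ m.+1]. *)
Let mu_B (s d : R) n : 0 < s ->
  (forall h : V, `|h| <= s -> (mu (inner Omega d `&` jump (E_ n) h) <= (C * (s + s))%:E)%E) ->
  (mu (B s d n) <= (2 ^+ m.+1 * (C * (s + s)))%:E)%E.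
Proof.
move=> s0 Hs; have sm0 : 0 < s ^+ m by rewrite exprn_gt0.
have := @mu2_difference_le _ _ _ _ (C * (s + s)) (mX s d n) (measurable_rV_cube (fun=> - s) (s + s)).
move=> H.
have HB : ((s ^+ m / 2)%:E * mu (B s d n) <= mu2 (X s d n))%E.
  by apply: le_measure_integral => //; rewrite divr_ge0// ltW.
have : ((s ^+ m / 2)%:E * mu (B s d n) <= (C * (s + s) * (s + s) ^+ m)%:E)%E.
  have -> : ((C * (s + s) * (s + s) ^+ m)%:E = (C * (s + s))%:E * mu (rV_cube (fun=> - s)%R (s + s)%R))%E.
    by rewrite lebesgue_rV_cube ?EFinM// addr_ge0// ltW.
  apply: (le_trans HB); apply: H.
  - by rewrite mulr_ge0// ?addr_ge0// ltW.
  - by move=> p [].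
  - move=> h hQ; apply: le_trans (Hs h _).
      apply: le_measure; rewrite ?inE.
      + rewrite (_ : [set x | _] = inner Omega d `&` jump (E_ n) h `&` [set x | rV_cube (fun=> - s) (s + s) h]); last first.
          apply/seteqP; split => x; rewrite /X/=; have xh : x + h - x = h by rewrite addrC addKr.
            by rewrite xh => -[? ? ?]; split=> //; split=> //; apply/jumpP.
          by rewrite xh => -[[? /jumpP ?] ?].
        apply: measurableI => //; first by apply: measurableI; [exact: measurable_inner|exact: measurable_jump].
        rewrite (_ : [set x | _] = setT)//; by apply/seteqP; split.
      + by apply: measurableI; [exact: measurable_inner|exact: measurable_jump].
      + by move=> x [/= ? _ /jumpP].
    apply/rV_normP; first exact: ltW.
    move=> i; have := hQ i; rewrite addrA addNr add0r ler_norml => /andP[-> /ltW ->]//.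
rewrite -lee_pdivlMl ?divr_gt0// => /le_trans; apply; rewrite -EFinM lee_fin.
have -> : s + s = 2 * s by ring.
rewrite le_eqVlt; apply/orP; left; apply/eqP; rewrite exprMn exprS.
by field; rewrite gt_eqF.
Qed.

(* The code of k records the majority phase of E_k in each cube of a fine grid. *)
Lemma finite_code (eta : R) : 0 < eta -> exists (T : finType) (c : nat -> T) (N : nat),
  forall i j, (N <= i)%N -> (N <= j)%N -> c i = c j -> (mu (E_ i `+` E_ j) <= eta%:E)%E.
Proof.
move=> eta0; have eta2 : 0 < eta / 2 by rewrite divr_gt0.
have [d d0 Od] := measure_setD_inner oO OM eta2.
(* Half of [eta] pays for the boundary layer and a quarter for each of the two bad sets;
   [s <= eta / D] is exactly what brings the bound of [mu_B] below [eta / 4]. *)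
pose D := 2 ^+ m.+1 * C * 8; have D0 : 0 < D by rewrite !mulr_gt0// exprn_gt0.
pose s := Num.min (d / 2) (eta / D).
have s0 : 0 < s by rewrite lt_min !divr_gt0.
have sd : s + s <= d.
  have : s <= d / 2 by rewrite ge_min lexx.
  by lra.
have sD : 2 ^+ m.+1 * (C * (s + s)) <= eta / 4.
  have : s <= eta / D by rewrite ge_min lexx orbT.
  rewrite ler_pdivlMr// /D => h; rewrite ler_pdivlMr//.
  by move: h; congr (_ <= _); ring.
have [N1 HN1] := jump_le s0; have [N2 HN2] := e_small s0.
(* Cubes per axis. The successor is needed for the half-open cubes to cover the end point [M]. *)
pose n := (Num.truncn ((M + M) / s)).+1.
pose Q (j : {ffun 'I_m -> 'I_n}) : set V := rV_cube (fun i => - M + s * (j i)%:R) s.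
have mQ j : measurable (Q j) by exact: measurable_rV_cube.
have cover x : Omega x -> exists j, Q j x.
  move=> /OM xM.
  have xi i : 0 <= x ord0 i + M <= M + M.
    have := le_trans (rV_norm_coord x i) xM; rewrite ler_norml => /andP[? ?].
    by apply/andP; split; lra.
  have ti i : (Num.truncn ((x ord0 i + M) / s) < n)%N.
    rewrite ltnS; apply: le_truncn; rewrite ler_pM2r ?invr_gt0//; by have /andP[] := xi i.
  exists [ffun i => Ordinal (ti i)] => i; rewrite ffunE/=.
  have /andP[xi0 _] := xi i.
  have /truncn_itv/andP[] : 0 <= (x ord0 i + M) / s by rewrite divr_ge0// ltW.
  rewrite ler_pdivlMr// ltr_pdivrMr// [X in _ < X -> _](_ : _ = s * (Num.trunc ((x ord0 i + M) / s))%:R + s); last by rewrite -natr1; ring.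
  rewrite mulrC => ? ?.
  by apply/andP; split; lra.
pose c k := [ffun j => (mu (Q j `\` E_ k) < mu (Q j `&` E_ k))%E].
exists {ffun {ffun 'I_m -> 'I_n} -> bool}, c, (maxn N1 N2).
move=> i j; rewrite !geq_max => /andP[i1 i2] /andP[j1 j2] cij.
have mBk k : (N1 <= k)%N -> (N2 <= k)%N -> (mu (B s d k) <= (eta / 4)%:E)%E.
  move=> k1 k2; apply: (@le_trans _ _ (2 ^+ m.+1 * (C * (s + s)))%:E); last by rewrite lee_fin.
  apply: mu_B => // h hs; apply: le_trans (_ : _ <= mu (inner Omega (s + s) `&` jump (E_ k) h))%E _.
    apply: le_measure; rewrite ?inE.
    + by apply: measurableI; [exact: measurable_inner|exact: measurable_jump].
    + by apply: measurableI; [exact: measurable_inner|exact: measurable_jump].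
    + by apply: setSI; exact: inner_le.
  apply: le_trans (HN1 _ _ k1 hs) _; rewrite lee_fin ler_wpM2l ?(ltW C0)// lerD//.
  exact: HN2.
(* If x is in the minority phase of its cube, then at least half of the cube lies
   in the other phase, whence x belongs to the small set B. *)
have half k q x : Q q x -> inner Omega d x -> (if c k q then ~ E_ k x else E_ k x) -> B s d k x.
  move=> Qx xd; rewrite ffunE => cE; rewrite /B/=.
  have sec y : Q q y -> ~ (E_ k x <-> E_ k y) -> xsection (X s d k) x y.
    move=> Qy xy; rewrite /xsection/= inE; split => //= l.
    have := Qx l; have := Qy l; rewrite !mxE => /andP[? ?] /andP[? ?].
    by apply/andP; split; lra.
  have mX' : measurable (xsection (X s d k) x) by exact: measurable_xsection.
  have QE : (mu (Q q `\` E_ k) + mu (Q q `&` E_ k) = (s ^+ m)%:E)%E.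
    rewrite -(@lebesgue_rV_cube R m (fun i => - M + s * (q i)%:R) s) ?ltW//.
    by rewrite -[RHS]/(mu (Q q)) -(measureDI (lebesgue_rV m) (mQ q) (mE k)).
  have mQE : measurable (Q q `&` E_ k) by exact: measurableI.
  have mQD : measurable (Q q `\` E_ k) by exact: measurableD.
  move: cE; case: ltP => [lt|le] xE.
    apply: le_trans (ge_half QE (ltW lt)) _; apply: le_measure; rewrite ?inE// => y [Qy Ey].
    by apply: sec => //; tauto.
  rewrite addeC in QE.
  apply: le_trans (ge_half QE le) _; apply: le_measure; rewrite ?inE// => y [Qy Ey].
  by apply: sec => //; tauto.
have -> : eta = eta / 2 + (eta / 4 + eta / 4) by field.
rewrite !EFinD; apply: (@measure_leU _ _ _ _ _ (Omega `\` inner Omega d) (B s d i `|` B s d j)).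
- exact: measurable_setY.
- by apply: measurableD; [exact: open_measurable_rV|exact: measurable_inner].
- exact: measurableU.
- move=> x xij; have Ox : Omega x by move: xij => [[/EO]|[/EO]].
  have [xd|xd] := pselect (inner Omega d x); last by left.
  (* Both indices have the same majority phase in the cube of [x], but only one of the two sets
     contains [x]; hence [x] is in the minority phase for one of them. *)
  right; have [q Qx] := cover _ Ox.
  have ci := half i q x Qx xd; have := half j q x Qx xd; rewrite -cij.
  case: (c i q) ci => ci cj; move: xij => [[x1 x2]|[x1 x2]]; [right|left|left|right]; tauto.
- exact: Od.
- by apply: (@measure_leU _ _ _ _ _ (B s d i) (B s d j)) => //; [exact: measurableU|exact: mBk|exact: mBk].
Qed.

(** Consecutive sets of the subsequence differ by at most [2^-(k+1)], and [E] is their upper limit.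
    A point that belongs to only one of [F i] and [E] must switch membership between some [F k] and
    [F k.+1] with [k >= i], so the distance to [E] is bounded by the tail of a convergent series. *)
Lemma sets_compact : exists2 sigma : nat -> nat, {homo sigma : i j / (i < j)%N} &
  exists2 E : set V, measurable E /\ E `<=` Omega &
  (mu (E_ (sigma i) `+` E) @[i --> \oo] --> 0)%E.
Proof.
have [|sigma sincr sP] := @diagonal_pigeonhole (fun k i j => (mu (E_ i `+` E_ j) <= (1 / (2 ^ k.+1)%:R)%:E)%E).
  by move=> k; apply: finite_code; rewrite divr_gt0// ltr0n expn_gt0.
exists sigma => //; pose F i := E_ (sigma i).
pose E := \bigcap_n \bigcup_(k >= n) F k.
have mF i : measurable (F i) by exact: mE.
have mEE : measurable E.
  by apply: bigcapT_measurable => n; apply: bigcup_measurable => k _; exact: mF.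
exists E; first split => //.
  by move=> x /(_ 0%N I)[k _ Fk]; exact: EO Fk.
have FE i : (mu (F i `+` E) <= \sum_(i <= k <oo) (1 / (2 ^ k.+1)%:R)%:E)%E.
  apply: le_trans (_ : _ <= \sum_(i <= k <oo) mu (F k `+` F k.+1))%E _.
    apply: measure_sigma_subadditive_tail.
    - by move=> k; exact: measurable_setY.
    - exact: measurable_setY.
    move=> x xFE.
    apply: contrapT => nx.
    have same k : (i <= k)%N -> F k x <-> F i x.
      move=> /subnK <-; elim: (k - i)%N => // n IH.
      apply: iff_trans IH; have [a|a] := pselect (F (n.+1 + i)%N x);
      have [b|b] := pselect (F (n + i)%N x) => //; exfalso; apply: nx; exists (n + i)%N => //=;
        rewrite ?ltnNge ?leq_addl//; rewrite -addSn.
      + by right.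
      + by left.
    case: xFE => [[Fi nE]|[EE nF]].
      by apply: nE => n _; exists (maxn n i); rewrite /= ?leq_maxl//; apply/same => //; exact: leq_maxr.
    have [k /= ik Fk] := EE i I; by apply/nF/(same k ik).
  by apply: lee_nneseries => // k _; apply: (sP k k k.+1).
apply: (@squeeze_cvge _ _ _ _ (cst 0%E) _ (fun i => \sum_(i <= k <oo) (1 / (2 ^ k.+1)%:R)%:E)%E).
- by apply: nearW => i; rewrite /= measure_ge0 FE.
- exact: cvg_cst.
- apply: nneseries_tail_cvg => [|k _]; last by rewrite lee_fin divr_ge0.
  by apply: le_lt_trans (epsilon_trick0 xpredT ler01) _; rewrite ltry.
Qed.

(** A jump of [E] is a jump of the approximating set unless the two sets differ at [x] or at
    [x + h]. Each of these errors, as well as [C] times the additive error [e_], is made at most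
    [t / 3]. *)
Lemma jump_limit (sigma : nat -> nat) (E : set V) : {homo sigma : i j / (i < j)%N} -> measurable E ->
  (mu (E_ (sigma i) `+` E) @[i --> \oo] --> 0)%E ->
  forall (d : R) (h : V), 0 < d -> `|h| <= d ->
  (mu (inner Omega (d + d) `&` jump E h) <= (C * `|h|)%:E)%E.
Proof.
move=> sincr mE' EE d h d0 hd; apply/lee_addgt0Pr => t t0.
have [N1 HN1] := jump_le d0.
have tC : 0 < t / 3 / C by rewrite !divr_gt0.
have t3 : 0 < t / 3 by rewrite divr_gt0.
have [N2 HN2] := e_small tC; have [N3 HN3] := cvge0_le EE t3.
pose i := maxn N1 (maxn N2 N3).
have si : (i <= sigma i)%N.
  elim: i => // k IH; exact: leq_ltn_trans IH (sincr _ _ (ltnSn k)).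
have i1 : (N1 <= sigma i)%N by apply: leq_trans si; exact: leq_maxl.
have i2 : (N2 <= sigma i)%N by apply: leq_trans si; rewrite /i maxnCA leq_maxl.
have i3 : (N3 <= i)%N by rewrite /i maxnC -maxnA maxnC -maxnA leq_maxl.
have mY : measurable (E_ (sigma i) `+` E) by exact: measurable_setY.
apply: (@le_trans _ _ ((C * (`|h| + e_ (sigma i)))%:E + ((t / 3)%:E + (t / 3)%:E))%E).
  apply: (@measure_leU _ _ _ _ _ (inner Omega (d + d) `&` jump (E_ (sigma i)) h)
    ((E_ (sigma i) `+` E) `|` [set x | (E_ (sigma i) `+` E) (x + h)])).
  - by apply: measurableI; [exact: measurable_inner|exact: measurable_jump].
  - by apply: measurableI; [exact: measurable_inner|exact: measurable_jump].
  - by apply: measurableU => //; exact: measurable_shift.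
  - move=> x [xd /jumpP xE].
    have [e|e] := pselect (jump (E_ (sigma i)) h x); [by left|right].
    have {}e : E_ (sigma i) x <-> E_ (sigma i) (x + h) by apply: contrapT => ne; apply: e; apply/jumpP.
    apply: contrapT => /not_orP[/not_orP[n1 n2] /not_orP[n3 n4]]; apply: xE.
    move: n1 n2 n3 n4; rewrite /=.
    have [a|a] := pselect (E_ (sigma i) x); have [b|b] := pselect (E_ (sigma i) (x + h));
      have [u|u] := pselect (E x); have [v|v] := pselect (E (x + h)); tauto.
  - exact: HN1.
  - apply: (@measure_leU _ _ _ _ _ (E_ (sigma i) `+` E) [set x | (E_ (sigma i) `+` E) (x + h)]) => //.
    + by apply: measurableU => //; exact: measurable_shift.
    + exact: measurable_shift.
    + exact: HN3.
    + by apply: lebesgue_rV_shift_le => //; exact: HN3.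
rewrite -!EFinD lee_fin mulrDr.
have : C * e_ (sigma i) <= t / 3.
  by rewrite mulrC -ler_pdivlMr//; exact: HN2.
by move=> ?; lra.
Qed.

End compactness.

(** * Finiteness of the perimeter *)

Section directional_derivatives.
Context {R : realType} (m : nat).
Local Notation V := 'rV[R]_m.

Lemma derivable_line (f : V -> R) (v x : V) (s : R) : derivable f (x + s *: v) v ->
  is_derive s (1 : R) (fun s => f (x + s *: v)) ('D_v f (x + s *: v)).
Proof.
move=> df.
have E : (fun h => h^-1 *: (((fun s => f (x + s *: v)) \o shift s) (h *: (1 : R)) - f (x + s *: v)))
    = (fun h => h^-1 *: ((f \o shift (x + s *: v)) (h *: v) - f (x + s *: v))).
  apply/funext => h /=; congr (_ *: (f _ - _)).
  by rewrite scalerDl [h *: 1]mulr1 addrCA.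
split; first by rewrite /derivable E.
by rewrite /derive E.
Qed.

Lemma le_increment (f : V -> R) (v x : V) (B t : R) :
  (forall x, derivable f x v) -> (forall x, `|'D_v f x| <= B) ->
  `|f (x + t *: v) - f x| <= B * `|t|.
Proof.
move=> df fB; pose g s := f (x + s *: v).
have gab a b : a < b -> `|g b - g a| <= B * (b - a).
  move=> ab; have [||c _ ->] := @MVT _ g (fun s => 'D_v f (x + s *: v)) a b ab.
  - by move=> s _; exact: derivable_line.
  - apply: derivable_within_continuous => s _.
    exact: (@ex_derive _ _ _ _ _ _ _ (derivable_line (df _))).
  - by rewrite normrM [`|b - a|]gtr0_norm ?subr_gt0// ler_wpM2r// subr_ge0 ltW.
have g0 : g 0 = f x by rewrite /g scale0r addr0.
rewrite -/(g t) -g0; case: (ltgtP t 0) => [t0|t0|->].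
- by rewrite distrC (ltr0_norm t0) -[- t]sub0r; exact: gab.
- by rewrite (gtr0_norm t0) -[X in B * X]subr0; exact: gab.
- by rewrite subrr !normr0 mulr0.
Qed.

(** Moving one coordinate at a time and applying the mean value theorem to each move shows that [f]
    is Lipschitz. *)
Lemma partials_bounded_continuous (f : V -> R) (B : R) :
  (forall i x, derivable f x (delta_mx 0 i)) ->
  (forall i x, `|partial_deriv i f x| <= B) -> continuous f.
Proof.
move=> df fB.
have step (s : seq 'I_m) (c : 'I_m -> R) x :
    `|f (x + \sum_(i <- s) c i *: delta_mx 0 i) - f x| <= \sum_(i <- s) B * `|c i|.
  elim: s x => [|i s IH] x; first by rewrite !big_nil addr0 subrr normr0.
  rewrite !big_cons addrA; set z := x + c i *: _; set y := z + _.
  rewrite (_ : f y - f x = (f y - f z) + (f z - f x)); last by rewrite addrA subrK.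
  apply: le_trans (ler_normD _ _) _; rewrite addrC; apply: lerD; last exact: IH.
    by apply: le_increment => // w; exact: fB.
have lip x y : `|f y - f x| <= \sum_(i < m) B * `|y - x|.
  rewrite -[in f y](subrKC x y); move: (y - x) => w.
  rewrite [in f _](row_sum_delta w); apply: le_trans (step _ _ _) _; apply: ler_sum => i _.
  rewrite ler_wpM2l//; first exact: le_trans (fB i x).
  exact: rV_norm_coord.
move=> x.
apply/(@cvgrPdist_le _ _ _ _ (nbhs_filter (x : V))) => e e0.
pose S := \sum_(i < m) `|B| + 1.
have S0 : 0 < S by rewrite ltr_wpDl// sumr_ge0.
near=> y; rewrite distrC; apply: le_trans (lip _ _) _.
apply: (@le_trans _ _ (S * `|y - x|)).
  rewrite -mulr_suml ler_wpM2r// (@le_trans _ _ (\sum_(i < m) `|B|))// ?lerDl//.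
  by apply: ler_sum => i _; exact: ler_norm.
rewrite -ler_pdivlMl// distrC; near: y; apply: cvgr_dist_le; first exact: cvg_id.
by rewrite mulr_gt0// invr_gt0.
Unshelve. all: by end_near. Qed.

Lemma bounded_of_compact_support (p : V -> R) (K : set V) : compact K -> continuous p ->
  (forall x, ~ K x -> p x = 0) -> exists B, forall x, `|p x| <= B.
Proof.
move=> cK cp pK.
have : compact (p @` K) by apply: continuous_compact => //; exact: continuous_subspaceT.
move=> /compact_bounded[B [Breal HB]].
exists (Num.max 0 (B + 1)) => x; have [Kx|nKx] := pselect (K x).
  by rewrite le_max; apply/orP; right; apply: HB; [rewrite ltrDl|exists x].
by rewrite pK// normr0 le_max lexx.
Qed.

Lemma derive_near0 (f : V -> R) (v x : V) : (\forall y \near x, f y = 0) -> 'D_v f x = 0.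
Proof.
by move=> f0; rewrite (near_eq_derive v (_ : \near x, f x = cst 0 x)) ?derive_cst.
Qed.

End directional_derivatives.

(** * Difference quotients integrated over a set *)

Section perimeter_bound.
Context {R : realType} (m : nat).
Local Notation V := 'rV[R]_m.
Local Notation mu := (lebesgue_rV m : set V -> \bar R).

Lemma integral_shift (E : set V) (f : V -> R) (v : V) :
  measurable E -> (mu E < +oo)%E -> measurable_fun setT f -> (forall x, `|f x| <= 1) ->
  (\int[mu]_(x in E) (f (x + v))%:E = \int[mu]_(x in [set x | E (x - v)%R]) (f x)%:E)%E.
Proof.
move=> mE Efin mf f1.
have mv : measurable_fun setT (fun x : V => x + v) by exact: measurable_rV_add.
have mE' : measurable [set x | E (x - v)] by exact: measurable_shift.
have EE : (fun x => x + v) @^-1` [set x | E (x - v)] = E.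
  by apply/seteqP; split => x; rewrite /= addrK.
have intf : (lebesgue_rV m).-integrable ((fun x => x + v) @^-1` [set x | E (x - v)]) ((EFin \o f) \o (fun x => x + v)).
  rewrite EE; apply: measurable_bounded_integrable => //.
    by apply: measurable_funTS; apply: measurableT_comp.
  by exists 1; split => // M M1 x _; rewrite /= (le_trans (f1 _))// ltW.
have := @integral_pushforward _ _ _ _ _ _ mv (lebesgue_rV m) _ (EFin \o f) _ intf mE'.
rewrite EE => <-; last exact/measurable_EFinP.
apply: eq_measure_integral => A mA _; exact: lebesgue_rV_shift.
Qed.

Lemma abse_integral_le_support (A K : set V) (f : V -> R) :
  measurable A -> measurable K -> measurable_fun setT f -> (forall x, `|f x| <= 1) ->
  (forall x, ~ K x -> f x = 0) -> (`|\int[mu]_(x in A) (f x)%:E| <= mu (A `&` K))%E.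
Proof.
move=> mA mK mf f1 fK.
have mfA : measurable_fun A (EFin \o f) by apply/measurable_EFinP; exact: measurable_funTS.
apply: le_trans (le_abse_integral (lebesgue_rV m) mA mfA) _.
rewrite setIC -[leRHS](integral_indic (lebesgue_rV m) mA mK).
apply: le_integral_nonmeas => // x Ax; rewrite /= lee_fin indicE.
case: (boolP (x \in K)) => [_|/negP nK]; first exact: f1.
by rewrite fK ?normr0// => Kx; apply: nK; rewrite inE.
Qed.

Variables (Omega E : set V) (M C : R).
Hypotheses (mE : measurable E) (EM : forall x, E x -> `|x| <= M) (C0 : 0 <= C).
Hypothesis jumpE : forall (d : R) (h : V), 0 < d -> `|h| <= d ->
  (mu (inner Omega (d + d) `&` jump E h) <= (C * `|h|)%:E)%E.

(** A discrete integration by parts: the translation passes from [f] to [E], the integrals over the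
    common part of [E] and its translate cancel, and what remains is an integral of a function
    bounded by 1 over the part of the jump by [- v] that lies in [K]. *)
Lemma increment_integral_le (f : V -> R) (K : set V) (d : R) (v : V) :
  continuous f -> (forall x, `|f x| <= 1) -> measurable K -> (forall x, ~ K x -> f x = 0) ->
  0 < d -> K `<=` inner Omega (d + d) -> `|v| <= d ->
  (\int[mu]_(x in E) (f (x + v) - f x)%:E <= (C * `|v|)%:E)%E.
Proof.
move=> cf f1 mK fK d0 KO vd.
have mf : measurable_fun setT f by exact: continuous_measurable_rV.
have Efin : (mu E < +oo)%E by apply: bounded_measure_lty EM.
have bint (A : set V) (g : V -> R) (B : R) : measurable A -> (mu A < +oo)%E -> measurable_fun setT g ->
    (forall x, `|g x| <= B) -> (lebesgue_rV m).-integrable A (EFin \o g).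
  move=> mA Afin mg gB; apply: measurable_bounded_integrable => //; first exact: measurable_funTS.
  by exists B; split; [exact: num_real|] => B' BB' x _; rewrite /= (le_trans (gB _))// ltW.
pose E' := [set x | E (x - v)].
have mE' : measurable E' by exact: measurable_shift.
have E'fin : (mu E' < +oo)%E by rewrite lebesgue_rV_shift.
have mfv : measurable_fun setT (fun x : V => f (x + v)).
  by apply: measurableT_comp => //; exact: measurable_rV_add.
under eq_integral do rewrite EFinB.
rewrite integralB_EFin//; [|exact: (bint _ _ 1)|exact: bint f1].
rewrite integral_shift//.
have iE : (lebesgue_rV m).-integrable E (EFin \o f) by exact: bint f1.
have iE' : (lebesgue_rV m).-integrable E' (EFin \o f) by exact: bint f1.
have splitI (A B : set V) : measurable A -> measurable B -> (lebesgue_rV m).-integrable A (EFin \o f) ->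
    (\int[mu]_(x in A) (f x)%:E = \int[mu]_(x in A `&` B) (f x)%:E + \int[mu]_(x in A `\` B) (f x)%:E)%E.
  move=> mA mB iA; rewrite -[in LHS](setUIDK A B) integral_setU//.
  - exact: measurableI.
  - exact: measurableD.
  - by rewrite setUIDK; exact: measurable_int iA.
  - by rewrite disj_set2E; apply/eqP; rewrite setIACA setICr setI0.
have mD : measurable (E `\` E') by exact: measurableD.
have mD' : measurable (E' `\` E) by exact: measurableD.
have mI : measurable (E' `&` E) by exact: measurableI.
have sub_fin A B : measurable B -> B `<=` A -> (lebesgue_rV m).-integrable A (EFin \o f) -> measurable A ->
    (\int[mu]_(x in B) (f x)%:E)%E \is a fin_num.
  by move=> mB BA iA mA; apply: integrable_fin_num => //; exact: integrableS iA.
rewrite (splitI E' E)// (splitI E E')// (setIC E E').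
have /fineK <- := sub_fin _ _ mI (@subIsetl _ _ _) iE' mE'.
have /fineK bE := sub_fin _ _ mD' (@subDsetl _ _ _) iE' mE'.
have /fineK cE := sub_fin _ _ mD (@subDsetl _ _ _) iE mE.
have : (`|\int[mu]_(x in E' `\` E) (f x)%:E| + `|\int[mu]_(x in E `\` E') (f x)%:E| <= (C * `|v|)%:E)%E.
  apply: (@le_trans _ _ (mu ((E' `\` E) `&` K) + mu ((E `\` E') `&` K))%E).
    by apply: leeD; exact: abse_integral_le_support.
  have <- : (mu (((E' `\` E) `&` K) `|` ((E `\` E') `&` K)) = mu ((E' `\` E) `&` K) + mu ((E `\` E') `&` K))%E.
    apply: measureU; [exact: measurableI|exact: measurableI|].
    by apply/seteqP; split => // x [[[_ ?] _] [[]]].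
  rewrite -normrN; apply: le_trans (jumpE d0 (_ : `|- v| <= d)); last by rewrite normrN.
  apply: le_measure; rewrite ?inE.
  - by apply: measurableU; exact: measurableI.
  - by apply: measurableI; [exact: measurable_inner|exact: measurable_jump].
  - by move=> x [[[? ?] Kx]|[[? ?] Kx]]; (split; first exact: KO); [right|left]; split.
rewrite -bE -cE -!EFinD !lee_fin; apply: le_trans.
set a := fine _; set b := fine _; set c := fine _.
rewrite opprD addrACA subrr add0r; apply: lerD; first exact: ler_norm.
by rewrite -normrN; exact: ler_norm.
Qed.

(** The bound for increments is divided by the step and passed to the limit; the mean value theorem
    supplies the constant [B] as dominating function. *)
Lemma derive_integral_le (f : V -> R) (K : set V) (d B : R) (v : V) :
  continuous f -> (forall x, `|f x| <= 1) -> measurable K -> (forall x, ~ K x -> f x = 0) ->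
  0 < d -> K `<=` inner Omega (d + d) -> `|v| <= 1 ->
  (forall x, derivable f x v) -> continuous ('D_v f) -> (forall x, `|'D_v f x| <= B) ->
  (\int[mu]_(x in E) ('D_v f x)%:E <= C%:E)%E.
Proof.
move=> cf f1 mK fK d0 KO v1 df cDf DB.
have Efin : (mu E < +oo)%E by apply: bounded_measure_lty EM.
have mf : measurable_fun setT f by exact: continuous_measurable_rV.
pose t (n : nat) : R := n.+1%:R^-1.
have t0 n : 0 < t n by rewrite invr_gt0.
pose g n x := (t n)^-1 * (f (x + t n *: v) - f x).
have mg n : measurable_fun setT (g n).
  apply: measurable_funM => //; apply: measurable_funB => //.
  by apply: measurableT_comp => //; exact: measurable_rV_add.
have gcvg x : g n x @[n --> \oo] --> 'D_v f x.
  rewrite (_ : g ^~ x = (fun h => h^-1 *: ((f \o shift x) (h *: v) - f x)) \o t); last first.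
    by apply/funext => n; rewrite /g /= [x + _]addrC.
  have tc : t n @[n --> \oo] --> (0 : R)^'.
    move=> A A0; have : \forall n \near \oo, t n != 0 -> A (t n) by exact: (@cvg_harmonic R _ A0).
    by apply: filterS => n; apply; rewrite gt_eqF.
  exact: cvg_comp tc (df x).
have : (\int[mu]_(x in E) (g n x)%:E @[n --> \oo] --> \int[mu]_(x in E) ('D_v f x)%:E)%E.
  apply: (@dominated_cvg _ _ _ _ _ mE _ _ (cst B%:E)) => //.
  - by move=> n; apply/measurable_EFinP; exact: measurable_funTS.
  - by move=> x _; apply: cvg_EFin; [exact: nearW|exact: gcvg].
  - by apply: measurable_bounded_integrable => //; exists `|B|; split; [exact: num_real|] => B' BB' x _; exact: ltW.
  - move=> n x _; rewrite /= lee_fin normrM normfV (gtr0_norm (t0 n)) ler_pdivrMl// mulrC.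
    apply: le_trans (le_increment _ _ df DB) _; by rewrite (gtr0_norm (t0 n)).
move=> /cvge_to_le; apply; near=> n.
have td : `|t n *: v| <= d.
  rewrite normrZ (gtr0_norm (t0 n)) (@le_trans _ _ (t n))//; first by rewrite ler_piMr// ltW.
  have : t n <= d by near: n; apply: (cvgr_le 0) => //; exact: cvg_harmonic.
  by [].
have mfv : measurable_fun setT (fun x : V => f (x + t n *: v)).
  by apply: measurableT_comp => //; exact: measurable_rV_add.
under eq_integral do rewrite EFinM.
rewrite integralZl//; last first.
  apply: measurable_bounded_integrable => //.
    by apply: measurable_funTS; exact: measurable_funB.
  exists 2; split; [exact: num_real|] => B' BB' x _; rewrite /= (le_trans (ler_normB _ _))//.
  by rewrite (le_trans (lerD (f1 _) (f1 _)))// ltW.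
apply: (@le_trans _ _ ((t n)^-1%:E * (C * `|t n *: v|)%:E)%E).
  apply: lee_wpmul2l; first by rewrite lee_fin invr_ge0 ltW.
  exact: increment_integral_le cf f1 mK fK d0 KO td.
rewrite -EFinM lee_fin normrZ (gtr0_norm (t0 n)) mulrCA mulKf ?gt_eqF//.
by rewrite ler_piMr.
Unshelve. all: by end_near. Qed.

End perimeter_bound.

Section compact_inner.
Context {R : realType} (m : nat).
Local Notation V := 'rV[R]_m.

Lemma compact_sub_inner (Omega K : set V) : open Omega -> compact K -> K `<=` Omega ->
  exists2 d : R, 0 < d & K `<=` inner Omega d.
Proof.
move=> oO /compact_near_coveringP cK KO.
have H : \forall d \near (0 : R)^'+, K `<=` inner Omega d.
  apply: cK => x Kx.
  have /nbhs_ballP[e/= e0 xeO] := open_nbhs_nbhs (conj oO (KO _ Kx)).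
  have e2 : 0 < e / 2 by rewrite divr_gt0.
  exists (ball x (e / 2), [set d | d < e / 2]).
    split; first exact: (nbhsx_ballx x).
    exact: nbhs_right_lt.
  move=> [y d] [/= xy de] h hd; apply: xeO; rewrite [e]splitr; apply: ball_triangle xy _.
  by rewrite -ball_normE/= opprD addrA subrr sub0r normrN; exact: lt_trans de.
near ((0 : R)^'+) => d; exists d; near: d; first exact: nbhs_right_gt.
exact: H.
Unshelve. all: by end_near. Qed.

End compact_inner.

Section perimeter.
Context {R : realType} (m : nat).
Local Notation V := 'rV[R]_m.
Local Notation mu := (lebesgue_rV m : set V -> \bar R).

Lemma enorm_coord (x : V) i : `|x ord0 i| <= enorm x.
Proof.
rewrite -sqrtr_sqr /enorm; apply: ler_wsqrtr.
by rewrite (bigD1 i)//= lerDl sumr_ge0// => j _; exact: sqr_ge0.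
Qed.

Lemma perimeter_lty (Omega E : set V) (M C : R) : open Omega -> measurable E -> E `<=` Omega ->
  (forall x, E x -> `|x| <= M) -> 0 <= C ->
  (forall (d : R) (h : V), 0 < d -> `|h| <= d ->
    (mu (inner Omega (d + d) `&` jump E h) <= (C * `|h|)%:E)%E) ->
  (perimeter E Omega < +oo)%E.
Proof.
move=> oO mE EO EM C0 jumpE.
(* The divergence is a sum of [m] derivatives along unit vectors, each contributing at most [C]. *)
apply: (@le_lt_trans _ _ (\sum_(i < m) C)%:E); last exact: ltry.
apply: ge_ereal_sup => _ [phi [C1 cK KO phi1] <-].
rewrite (setIidl EO); set K := closure _ in cK KO.
have [d d0 Kd] := compact_sub_inner oO cK KO.
have d2 : 0 < d / 2 by rewrite divr_gt0.
rewrite [d]splitr in Kd.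
have clK : closed K by exact: closed_closure.
have mK : measurable K by rewrite -[K]setCK; apply: measurableC; apply: open_measurable_rV; exact: closed_openC.
have phiK x : ~ K x -> phi x = 0.
  by move=> nK; apply/eqP/negP => /negP p0; apply: nK; exact: subset_closure.
pose f i y : R := phi y ord0 i.
have f1 i x : `|f i x| <= 1 by apply: le_trans (phi1 x); exact: enorm_coord.
have fK i x : ~ K x -> f i x = 0 by move=> /phiK; rewrite /f => ->; rewrite mxE.
have df i j x : derivable (f i) x (delta_mx 0 j) by exact: (C1 j i).1.
have cdf i j : continuous (partial_deriv j (f i)) by exact: (C1 j i).2.
have dfK i j x : ~ K x -> partial_deriv j (f i) x = 0.
  move=> nK; apply: derive_near0.
  have : open_nbhs x (~` K) by split => //; exact: closed_openC.
  by move=> /open_nbhs_nbhs; apply: filterS => y; exact: fK.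
have /choice[B HB] : forall ij : 'I_m * 'I_m, exists B, forall x, `|partial_deriv ij.2 (f ij.1) x| <= B.
  move=> ij; apply: (bounded_of_compact_support cK); first exact: cdf.
  exact: dfK.
(* C1_field only provides the partial derivatives, so continuity has to be derived. *)
have cf i : continuous (f i).
  apply: (@partials_bounded_continuous _ _ _ (\sum_j `|B (i, j)|)) => // j x.
  apply: le_trans (HB (i, j) x) _; rewrite (bigD1 j)//= (le_trans (ler_norm _))// lerDl.
  exact: sumr_ge0.
have Efin : (mu E < +oo)%E by apply: bounded_measure_lty EM.
have intd i : (lebesgue_rV m).-integrable E (EFin \o partial_deriv i (f i)).
  apply: measurable_bounded_integrable => //.
    by apply: measurable_funTS; exact: continuous_measurable_rV.
  exists (B (i, i)); split; [exact: num_real|] => B' BB' x _.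
  by rewrite /= (le_trans (HB (i, i) x))// ltW.
rewrite /divergence; under eq_integral do rewrite -sumEFin.
rewrite (integral_sum mE intd) -sumEFin; apply: lee_sum => i _.
apply: (derive_integral_le mE EM C0 jumpE (cf i) (f1 i) mK (fK i) d2 Kd _ _ (cdf i i) (HB (i, i))).
- by apply/rV_normP => // j; rewrite mxE; case: (_ && _); rewrite ?normr1 ?normr0.
- by move=> x; exact: df.
Qed.

End perimeter.

(** * Phases and energy *)

Section borel_representatives.
Context {R : realType} (m : nat).
Local Notation V := 'rV[R]_m.
Local Notation mu := (lebesgue_rV m : set V -> \bar R).

(** Only countably many superlevel sets, those at rational heights, have to be corrected. [N] is the
    union of their Borel null exceptional sets, and off [N] these heights determine [f]. *)
Lemma borel_representative (D : set V) (f : V -> R) : measurable D -> lebesgue_measurable_fun D f ->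
  exists N : set V, exists g : V -> R, [/\ measurable N /\ mu N = 0%E, measurable_fun setT g,
    forall x, (D `\` N) x -> g x = f x & forall x, ~ (D `\` N) x -> g x = 0].
Proof.
move=> mD mf.
have /choice[AB HAB] : forall q : rat, exists AB : set V * set V,
    [/\ measurable AB.1, measurable AB.2, mu AB.2 = 0%E &
     forall x, ~ AB.2 x -> (D x /\ ratr q < f x) <-> AB.1 x].
  move=> q; have [A mA [N0 [B [mB B0 NB]]] AE] := mf `]ratr q, +oo[%classic (measurable_itv _).
  exists (A, B); split => //= x nB.
  have -> : (D x /\ ratr q < f x) <-> (A `|` N0) x.
    by rewrite AE /=; rewrite in_itv/= andbT.
  by split=> [[//|/NB]|Ax]; [|left].
pose BB n := if unpickle n is Some q then (AB q).2 else set0.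
pose N := \bigcup_n BB n.
have mN : measurable N.
  by apply: bigcupT_measurable => n; rewrite /BB; case: unpickle => // q; have [] := HAB q.
have N0 : mu N = 0%E.
  apply: measure_negligible => //; apply: negligible_bigcup => n; rewrite /BB.
  case: unpickle => [q|]; last exact: negligible_set0.
  by have [? ? ? ?] := HAB q; apply/negligibleP.
have NAB q x : ~ N x -> ~ (AB q).2 x.
  by apply: contra_not => Bx; exists (pickle q); [exact: I|rewrite /BB pickleK].
pose g x := if x \in D `\` N then f x else 0.
exists N, g; split => //; last 2 first.
- by move=> x Dx; rewrite /g mem_set.
- by move=> x Dx; rewrite /g memNset.
apply: (measurability _ (RGenOInfty.measurableE R)) => //.
move=> _ [_ [a ->] <-]; rewrite setTI.
have mDN : measurable (D `\` N) by exact: measurableD.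
(* Off its domain [g] is 0, so that part belongs to the superlevel set exactly when [a < 0]. *)
rewrite (_ : _ @^-1` _ = (D `\` N) `&` (\bigcup_(q in [set q : rat | a <= ratr q]) (AB q).1)
   `|` (if a < 0 then ~` (D `\` N) else set0)).
  apply: measurableU; last by case: ifP => // _; exact: measurableC.
  apply: measurableI => //; rewrite bigcup_mkcond; apply: bigcupT_measurable_rat => q.
  by case: ifP => // _; have [] := HAB q.
apply/seteqP; split => x; rewrite /= in_itv/= andbT /g.
  case: ifPn => [/set_mem xD ax|/negP xD a0].
    left; split=> //; have /rat_in_itvoo[q] := ax; rewrite in_itv/= => /andP[aq qf].
    exists q; first exact: ltW.
    by have [_ _ _ H] := HAB q; apply/H => //; [apply: NAB; exact: xD.2|split => //; exact: xD.1].
  by right; rewrite a0 => Dx; apply: xD; rewrite inE.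
move=> [[Dx [q /= aq Aq]]|].
  rewrite mem_set//; have [_ _ _ H] := HAB q.
  by have [_ qf] := (H x (NAB q x Dx.2)).2 Aq; exact: le_lt_trans qf.
by case: ifP => // a0 nD; rewrite memNset.
Qed.

Lemma kernel_set (J : V -> R) : (forall h, 0 <= J h) -> (forall h, J (- h) = J h) ->
  lebesgue_measurable_fun [set: V] J -> ~ {ae lebesgue_rV m, forall h, J h = 0} ->
  exists (A : set V) (K c : R), [/\ 0 < c, measurable A, (0 < mu A)%E &
   [/\ forall x, A x -> `|x| <= K, forall x, A x -> A (- x) & forall x, A x -> c <= J x]].
Proof.
move=> J0 JN mJ nJ.
have [N [g [[mN N0] mg gJ g0]]] := borel_representative measurableT mJ.
have gleJ x : g x <= J x.
  by have [xN|xN] := pselect (([set: V] `\` N) x); [rewrite gJ|rewrite g0].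
pose G c : set V := [set x | c <= g x].
have mG c : measurable (G c).
  have -> : G c = g @^-1` `[c, +oo[ by apply/seteqP; split => x; rewrite /= in_itv/= andbT.
  exact: measurable_preimageT.
(* The reflected set is added because [g], unlike [J], need not be even. The lower bound survives on
   it since [J] is even. *)
pose A n : set V := [set x | `|x| <= n%:R] `&` (G n.+1%:R^-1 `|` [set x | G n.+1%:R^-1 (- x)]).
have mA n : measurable (A n).
  apply: measurableI; first exact: measurable_le_norm.
  apply: measurableU => //; apply: (@measurable_preimageT _ _ _ _ (fun x : V => - x)) => //.
  exact: measurable_rV_opp.
have [n An] : exists n, mu (A n) <> 0%E.
  apply: contrapT => /forallNP nA; apply: nJ.
  exists (N `|` \bigcup_n A n); split.
  - by apply: measurableU => //; exact: bigcupT_measurable.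
  - apply: measure_negligible; first by apply: measurableU => //; exact: bigcupT_measurable.
    apply: negligibleU; first by apply/negligibleP.
    by apply: negligible_bigcup => n; apply/negligibleP => //; apply: contrapT => /nA.
  move=> x /= /eqP Jx; have [Nx|nNx] := pselect (N x); [by left|right].
  have gx : 0 < g x by rewrite gJ ?lt0r ?Jx ?J0.
  have [n1 gn] := ltr_add_invr gx; rewrite add0r in gn.
  pose n := maxn n1 (Num.truncn `|x|).+1; exists n => //; split => /=.
    by apply: (le_trans (ltW (truncnS_gt _))); rewrite ler_nat leq_maxr.
  left; rewrite /G/=; apply: le_trans (ltW gn).
  by rewrite lef_pV2 ?posrE// ler_nat ltnS leq_maxl.
exists (A n), n%:R, n.+1%:R^-1; split => //.
  by rewrite lt0e; apply/andP; split => //; exact/eqP.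
split.
- by move=> x [].
- by move=> x [xn Gx]; split; rewrite /= ?normrN// opprK; case: Gx; [right|left].
- move=> x [_ [Gx|Gx]]; first exact: le_trans Gx (gleJ x).
  by rewrite -JN; exact: le_trans Gx (gleJ _).
Qed.

End borel_representatives.

(** * The distance to the wells and the potential *)

Section potential.
Context {R : realType} (m : nat).
Local Notation V := 'rV[R]_m.

Lemma enorm_le (x : V) : enorm x <= Num.sqrt m%:R * `|x|.
Proof.
rewrite -[leRHS]ger0_norm ?mulr_ge0// -[leRHS]sqrtr_sqr; apply: ler_wsqrtr.
rewrite exprMn sqr_sqrtr// mulr_natl (_ : _ *+ m = \sum_(i < m) `|x| ^+ 2); last by rewrite sumr_const card_ord.
apply: ler_sum => i _; rewrite -real_normK ?num_real//.
by rewrite ler_sqr ?nnegrE//; exact: rV_norm_coord.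
Qed.

Lemma holder_uniform (alpha : R) (z : V -> R) (eta : R) : 0 < alpha -> holder alpha z -> 0 < eta ->
  exists2 r : R, 0 < r & forall x y, `|x - y| <= r -> `|z x - z y| <= eta.
Proof.
move=> a0 [C zC] eta0.
(* This [s] solves [(|C| + 1) * s^alpha = eta]; the later division by [sqrt m + 1] passes from the
   Euclidean norm to the sup norm. *)
pose s : R := (eta / (`|C| + 1)) `^ alpha^-1.
have C1 : 0 < `|C| + 1 by rewrite ltr_wpDl.
have s0 : 0 < s by rewrite powR_gt0// divr_gt0.
have q0 : 0 < Num.sqrt (m%:R : R) + 1 by rewrite ltr_wpDl// sqrtr_ge0.
exists (s / (Num.sqrt m%:R + 1)); first by rewrite divr_gt0.
move=> x y xy; apply: le_trans (zC x y) _.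
have es : enorm (x - y) <= s.
  apply: le_trans (enorm_le _) _; move: xy; rewrite ler_pdivlMr// mulrC => /(le_trans _); apply.
  by rewrite ler_wpM2r// lerDl.
have : enorm (x - y) `^ alpha <= eta / (`|C| + 1).
  rewrite (_ : eta / _ = s `^ alpha).
    by rewrite ge0_ler_powR// ?nnegrE ?sqrtr_ge0// ltW.
  by rewrite /s -powRrM mulVf ?gt_eqF// powRr1// divr_ge0 ?ltW.
rewrite ler_pdivlMr// mulrC; apply: le_trans; rewrite ler_wpM2r ?powR_ge0//.
by apply: le_trans (ler_norm _) _; rewrite lerDl.
Qed.

Lemma holder_continuous (alpha : R) (z : V -> R) : 0 < alpha -> holder alpha z -> continuous z.
Proof.
move=> a0 hz x; apply/(@cvgrPdist_le _ _ _ _ (nbhs_filter (x : V))) => e e0.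
have [r r0 H] := holder_uniform a0 hz e0.
near=> y; apply: H; near: y; apply: cvgr_dist_le => //; exact: cvg_id.
Unshelve. all: by end_near. Qed.

Definition well_dist (z1 z2 : V -> R) (x : V) (t : R) : R := Num.min `|t - z1 x| `|t - z2 x|.

(** [W] may vanish to high order at the wells, so a slack [eta] is allowed and [C] depends on it. At
    distance at least [eta] from the wells, [W] is bounded below by compactness when
    [|t| <= 1/delta], and it grows linearly beyond. *)
Lemma well_dist_le_potential (W : V -> R -> R) (z1 z2 : V -> R) (K : set V) (delta eta : R) :
  compact K -> continuous (fun p : V * R => W p.1 p.2) -> continuous z1 -> continuous z2 ->
  (forall x t, 0 <= W x t) -> (forall x t, W x t = 0 <-> t = z1 x \/ t = z2 x) ->
  0 < delta -> W5 W K delta -> 0 < eta ->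
  exists2 C : R, 0 < C & forall x t, K x -> well_dist z1 z2 x t <= eta + C * W x t.
Proof.
move=> cK cW cz1 cz2 W0 Wz d0 HW5 eta0.
have [Kne|Ke] := pselect (K !=set0); last first.
  by exists 1 => // x t Kx; exfalso; apply: Ke; exists x.
have [Z HZ] : exists Z, forall x, K x -> `|z1 x| <= Z.
  have : compact (z1 @` K) by apply: continuous_compact => //; exact: continuous_subspaceT.
  move=> /compact_bounded[B [Breal HB]]; exists (B + 1) => x Kx.
  by apply: HB; [rewrite ltrDl|exists x].
have Z0 : 0 <= Z by have [x Kx] := Kne; exact: le_trans (HZ _ Kx).
pose a := delta^-1.
(* Penalizing the neighbourhood of the wells keeps the minimum positive without
   having to remove that neighbourhood from the compact set. *)
pose Phi (p : V * R) := W p.1 p.2 + Num.max 0 (eta - well_dist z1 z2 p.1 p.2).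
have cz (z : V -> R) : continuous z -> continuous (fun p : V * R => `|p.2 - z p.1|).
  move=> cz p; apply: cvg_norm; apply: cvgB; first exact: cvg_snd.
  by apply: cvg_comp; [exact: cvg_fst|exact: cz].
have cPhi : continuous Phi.
  move=> p; apply: cvgD; first exact: cW.
  apply: (@continuous_max _ _ (cst 0) (fun p => eta - well_dist z1 z2 p.1 p.2)); first exact: cst_continuous.
  apply: cvgB; first exact: cvg_cst.
  by apply: (@continuous_min _ _ (fun p : V * R => `|p.2 - z1 p.1|) (fun p => `|p.2 - z2 p.1|)); exact: cz.
have a0 : 0 < a by rewrite invr_gt0.
have cKa : compact (K `*` `[- a, a]%classic) by apply: compact_setX => //; exact: segment_compact.
have [|[x0 t0] /set_mem[Kx0 _] Pmin] := compact_EVT_min _ cKa (continuous_subspaceT cPhi).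
  by have [x Kx] := Kne; exists (x, 0); split => //=; rewrite in_itv/= oppr_le0 ltW//= ltW.
pose c := Phi (x0, t0).
have c0 : 0 < c.
  rewrite /c /Phi/=; have [d_lt|d_ge] := ltP (well_dist z1 z2 x0 t0) eta.
    by rewrite ltr_wpDl// lt_max subr_gt0 d_lt orbT.
  rewrite ltr_pwDl// ?le_max ?lexx// lt0r W0 andbT; apply/eqP => /Wz t0z.
  suff wd0 : well_dist z1 z2 x0 t0 = 0 by move: d_ge; rewrite wd0 leNgt eta0.
  rewrite /well_dist; case: t0z => ->; rewrite subrr normr0.
    by apply/min_idPl.
  by apply/min_idPr.
have D0 : 0 <= (a + Z) / c by apply: divr_ge0; [apply: addr_ge0 => //; exact: ltW|exact: ltW].
(* The term [(a + Z) / c] serves bounded [t], where the distance is at most [a + Z] and [W] at least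
   [c]. The terms [a + Z] serve large [t], where [|t| <= a * W] and [W >= 1]. *)
exists ((a + Z) / c + a + Z); first by rewrite -addrA ltr_wpDl// ltr_pwDl.
move=> x t Kx.
have wdZ : well_dist z1 z2 x t <= `|t| + Z.
  rewrite /well_dist; apply: (@le_trans _ _ `|t - z1 x|); first by rewrite ge_min lexx.
  by apply: le_trans (ler_normB _ _) _; rewrite lerD2l HZ.
have [ta|at_] := leP `|t| a; last first.
  have dW := HW5 x t Kx at_.
  have W1 : 1 <= W x t.
    apply: le_trans dW; rewrite -ler_pdivrMl// mulr1; exact: ltW.
  have tW : `|t| <= a * W x t by rewrite ler_pdivlMl.
  apply: (@le_trans _ _ (a * W x t + Z * W x t)).
    by apply: le_trans wdZ _; rewrite lerD// ler_peMr.
  rewrite -mulrDl; apply: (@le_trans _ _ (((a + Z) / c + a + Z) * W x t)).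
    by rewrite ler_wpM2r// -addrA lerDr.
  by rewrite lerDr ltW.
have [d_lt|d_ge] := ltP (well_dist z1 z2 x t) eta.
  rewrite (le_trans (ltW d_lt))// lerDl mulr_ge0// !addr_ge0// ltW//.
have cW' : c <= W x t.
  have := Pmin (x, t); rewrite inE /= in_itv/= -ler_norml => /(_ (conj Kx ta)).
  by rewrite /Phi/=; move/max_idPl : (d_ge); rewrite -/(Phi _) => _; rewrite [X in _ <= _ + X]max_l ?subr_le0// addr0.
apply: (@le_trans _ _ ((a + Z) / c * W x t)).
  apply: (le_trans wdZ); apply: (@le_trans _ _ ((a + Z) / c * c)).
    by rewrite mulfVK ?gt_eqF// lerD2r.
  by rewrite ler_wpM2l.
apply: (@le_trans _ _ (((a + Z) / c + a + Z) * W x t)).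
  by rewrite ler_wpM2r// -addrA lerDl addr_ge0// ltW.
by rewrite lerDr ltW.
Qed.

End potential.

Section null_sets.
Local Open Scope ereal_scope.
Context d (T : measurableType d) (R : realType).
Variable mu : {measure set T -> \bar R}.

(** Raising the majorant to [+oo] on [N] leaves its integral unchanged and makes the comparison hold
    everywhere on [D], so that nothing is asked of the measurability of [f]. *)
Lemma le_integral_null (D N : set T) (f g : T -> \bar R) : measurable D -> measurable N -> mu N = 0 ->
  measurable_fun setT g -> (forall x, D x -> 0 <= f x) -> (forall x, 0 <= g x) ->
  (forall x, (D `\` N) x -> f x <= g x) ->
  \int[mu]_(x in D) f x <= \int[mu]_(x in D) g x.
Proof.
move=> mD mN N0 mg f0 g0 fg.
pose G x := if x \in N then +oo else g x.
have G0 x : 0 <= G x by rewrite /G; case: ifP.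
have mG : measurable_fun setT G.
  move=> _ Y mY; rewrite setTI.
  rewrite (_ : G @^-1` Y = (if +oo \in Y then N else set0) `|` (~` N `&` g @^-1` Y)).
    apply: measurableU; first by case: ifP.
    by apply: measurableI; [exact: measurableC|exact: measurable_preimageT].
  apply/seteqP; split => x; rewrite /G /=.
    case: ifPn => [/set_mem Nx Yoo|/negP Nx Yg]; first by left; rewrite mem_set.
    by right; split => // ?; apply: Nx; rewrite inE.
  move=> [|[Nx Yg]]; last by rewrite memNset.
  by case: ifPn => // /set_mem Yoo Nx; rewrite mem_set.
apply: (@le_trans _ _ (\int[mu]_(x in D) G x)).
  apply: le_integral_nonmeas => // x Dx; rewrite /G; case: ifPn => [_|/negP Nx]; first exact: leey.
  by apply: fg; split => // ?; apply: Nx; rewrite inE.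
rewrite le_eqVlt; apply/orP; left; apply/eqP; apply: ge0_ae_eq_integral => //.
- exact: measurable_funTS.
- exact: measurable_funTS.
- exists N; split => // x /= /not_implyP[_]; apply: contra_notP => Nx.
  by rewrite /G memNset.
Qed.

End null_sets.

(** * Consequences of the energy bound *)

Section energy_bounds.
Context {R : realType} (m : nat).
Local Notation V := 'rV[R]_m.
Local Notation mu := (lebesgue_rV m : set V -> \bar R).
Local Notation mu2 := ((lebesgue_rV m \x lebesgue_rV m)%E : set (V * V) -> \bar R).

Variables (Omega : set V) (J : V -> R) (W : V -> R -> R).
Hypotheses (mO : measurable Omega) (J0 : forall h, 0 <= J h) (W0 : forall x t, 0 <= W x t).

Lemma energy_le (e M : R) (u : V -> R) : 0 < e -> (energy Omega J W e u <= M%:E)%E ->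
  (\int[mu]_(x in Omega) (W x (u x))%:E <= (e * M)%:E)%E /\
  (\int[mu2]_(p in Omega `*` Omega)
       (e ^- m * J (e^-1 *: (p.1 - p.2)) * `|u p.1 - u p.2| ^+ 2)%:E <= (4 * e * M)%:E)%E.
Proof.
move=> e0; rewrite /energy; set I2 := integral _ _ _; set I1 := integral _ _ _ => EM.
have I10 : (0 <= I1)%E by apply: integral_ge0 => x _; rewrite lee_fin.
have I20 : (0 <= I2)%E.
  apply: integral_ge0 => x _; rewrite lee_fin; apply: mulr_ge0; last exact: sqr_ge0.
  by apply: mulr_ge0 => //; rewrite invr_ge0 exprn_ge0// ltW.
have e4 : 0 < 4 * e by rewrite mulr_gt0.
split.
- have : (e^-1%:E * I1 <= M%:E)%E.
    by apply: le_trans EM; apply: leeDr; rewrite mule_ge0// lee_fin invr_ge0 ltW.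
  by rewrite lee_pdivrMl// EFinM.
- have : ((4 * e)^-1%:E * I2 <= M%:E)%E.
    by apply: le_trans EM; apply: leeDl; rewrite mule_ge0// lee_fin invr_ge0 ltW.
  by rewrite lee_pdivrMl// EFinM.
Qed.

Variables (A : set V) (K c : R) (z1 z2 : V -> R) (delta r Cd : R).
Hypotheses (mA : measurable A) (AK : forall x, A x -> `|x| <= K)
  (AN : forall x, A x -> A (- x)) (c0 : 0 < c) (cJ : forall x, A x -> c <= J x).
Hypotheses (cz1 : continuous z1) (cz2 : continuous z2) (delta0 : 0 < delta)
  (gap : forall x, Omega x -> 8 * delta < z2 x - z1 x) (Cd0 : 0 < Cd)
  (wdW : forall x t, Omega x -> well_dist z1 z2 x t <= delta / 2 + Cd * W x t)
  (z1r : forall x y, `|x - y| <= r -> `|z1 x - z1 y| <= delta)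
  (z2r : forall x y, `|x - y| <= r -> `|z2 x - z2 y| <= delta).

Definition phase (N : set V) (g : V -> R) : set V :=
  (Omega `\` N) `&` [set x | g x <= (z1 x + z2 x) / 2].

Lemma measurable_phase N g : measurable N -> measurable_fun setT g -> measurable (phase N g).
Proof.
move=> mN mg; apply: measurableI; first exact: measurableD.
have mz : measurable_fun setT (fun x => (z1 x + z2 x) / 2).
  by apply: measurable_funM => //; apply: measurable_funD; exact: continuous_measurable_rV.
have -> : [set x | g x <= (z1 x + z2 x) / 2] = (fun x => g x - (z1 x + z2 x) / 2) @^-1` `]-oo, 0].
  by apply/seteqP; split => x; rewrite /= in_itv/= subr_le0.
by apply: measurable_preimageT => //; exact: measurable_funB.
Qed.

Lemma measurable_well_dist g : measurable_fun setT g ->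
  measurable_fun setT (fun x => well_dist z1 z2 x (g x)).
Proof.
move=> mg; apply: (@measurable_minr _ _ _ _ (fun x => `|g x - z1 x|) (fun x => `|g x - z2 x|));
  by apply: measurableT_comp => //; apply: measurable_funB => //; exact: continuous_measurable_rV.
Qed.

Lemma phase_well N g x : (Omega `\` N) x -> well_dist z1 z2 x (g x) < delta ->
  (phase N g x -> `|g x - z1 x| < delta) /\ (~ phase N g x -> `|g x - z2 x| < delta).
Proof.
move=> [Ox Nx]; have := gap Ox; rewrite /well_dist gt_min => zz /orP wd; split.
  move=> [_ /=]; rewrite ler_pdivlMr// => gx; case: wd => //.
  by rewrite !ltr_norml => /andP[? ?]; apply/andP; split; lra.
move=> np; have {}np : (z1 x + z2 x) / 2 < g x by rewrite ltNge; apply/negP => gx; apply: np.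
move: np; rewrite ltr_pdivrMr// => gx; case: wd => //.
by rewrite !ltr_norml => /andP[? ?]; apply/andP; split; lra.
Qed.

(** Outside null sets, either one point of the pair is far from both wells, which is rare by the
    potential term, or both values are close to different wells and the nonlocal term charges the
    pair with a fixed jump. Points at distance at most [r] are compared because the wells themselves
    vary with [x]. *)
Lemma pairs_energy (M : R) : 0 <= M -> exists2 C : R, 0 <= C &
  forall (e : R) u N g, 0 < e -> K * e <= r -> (energy Omega J W e u <= M%:E)%E ->
  measurable N -> mu N = 0%E -> measurable_fun setT g ->
  (forall x, (Omega `\` N) x -> g x = u x) ->
  (mu2 (pairs Omega A e (phase N g)) <= (C * e ^+ m.+1)%:E)%E.
Proof.
move=> M0; have Afin : mu A \is a fin_num by rewrite ge0_fin_numE//; exact: bounded_measure_lty AK.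
pose a := fine (mu A); have a0 : 0 <= a by exact: fine_ge0.
(* Both constants come from Markov's inequality: on [B] the potential is at least [delta / 2 / Cd],
   and on [P1] the nonlocal integrand is at least [e ^- m * c * delta ^+ 2]. *)
pose Ca := Cd * M / (delta / 2); pose Cb := 4 * M / (c * delta ^+ 2).
have d2 : 0 < delta / 2 by rewrite divr_gt0.
have Ca0 : 0 <= Ca by rewrite divr_ge0 ?mulr_ge0// ltW.
have cd : 0 < c * delta ^+ 2 by rewrite mulr_gt0// exprn_gt0.
have Cb0 : 0 <= Cb by rewrite divr_ge0 ?mulr_ge0// ltW.
exists (Cb + (Ca * a + Ca * a)); first by rewrite addr_ge0 ?addr_ge0// mulr_ge0.
move=> e u N g e0 Ker EM mN N0 mg gu.
have [E1 E2] := energy_le e0 EM.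
have em : 0 < e ^+ m by rewrite exprn_gt0.
have mP := measurable_phase mN mg.
pose B : set V := (Omega `\` N) `&` [set x | delta <= well_dist z1 z2 x (g x)].
have mB : measurable B.
  apply: measurableI; first exact: measurableD.
  have -> : [set x | delta <= well_dist z1 z2 x (g x)] = (fun x => well_dist z1 z2 x (g x)) @^-1` `[delta, +oo[.
    by apply/seteqP; split => x; rewrite /= in_itv/= andbT.
  by apply: measurable_preimageT => //; exact: measurable_well_dist.
have muB : (mu B <= (Ca * e)%:E)%E.
  have : ((delta / 2 / Cd)%:E * mu B <= (e * M)%:E)%E.
    apply: le_trans E1; apply: le_measure_integral => //.
    - by move=> x [[]].
    - by rewrite divr_ge0// ltW.
    - by move=> x _; rewrite lee_fin.
    - move=> x [[Ox Nx] /= xB]; rewrite lee_fin ler_pdivrMr// -(gu x (conj Ox Nx)).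
      have := wdW (g x) Ox; rewrite [W _ _ * _]mulrC; lra.
  rewrite -lee_pdivlMl ?divr_gt0// => /le_trans; apply; rewrite -EFinM lee_fin /Ca.
  by rewrite le_eqVlt; apply/orP; left; apply/eqP; field; rewrite !gt_eqF.
pose P1 : set (V * V) := pairs (Omega `\` N) A e (phase N g) `&` [set p | delta <= `|g p.1 - g p.2|].
have mA' : measurable [set x | A (e^-1 *: x)].
  by apply: (@measurable_preimageT _ _ _ _ (fun x : V => e^-1 *: x)) => //; exact: measurable_rV_scale.
have mP1 : measurable P1.
  apply: measurableI; first by apply: measurable_pairs => //; exact: measurableD.
  have -> : [set p : V * V | delta <= `|g p.1 - g p.2|] = (fun p : V * V => `|g p.1 - g p.2|) @^-1` `[delta, +oo[.
    by apply/seteqP; split => x; rewrite /= in_itv/= andbT.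
  apply: measurable_preimageT => //; apply: measurableT_comp => //.
  by apply: measurable_funB; apply: measurableT_comp.
have muP1 : (mu2 P1 <= (Cb * e ^+ m.+1)%:E)%E.
  have : ((e ^- m * c * delta ^+ 2)%:E * mu2 P1 <= (4 * e * M)%:E)%E.
    apply: le_trans E2; apply: le_measure_integral => //.
    - exact: measurableX.
    - by move=> p [[[? _] [? _]]].
    - by rewrite !mulr_ge0// ?exprn_ge0 ?invr_ge0 ?exprn_ge0// ltW.
    - move=> p _; rewrite lee_fin; apply: mulr_ge0; last exact: sqr_ge0.
      by apply: mulr_ge0 => //; rewrite invr_ge0 exprn_ge0// ltW.
    - move=> p [[w1 w2 Ap _] /= dg]; rewrite lee_fin -!gu//; apply: ler_pM.
      + by rewrite mulr_ge0// ?invr_ge0 ?exprn_ge0// ltW.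
      + by rewrite exprn_ge0// ltW.
      + by rewrite ler_wpM2l ?cJ// invr_ge0 exprn_ge0// ltW.
      + by rewrite ler_sqr ?nnegrE// ltW.
  have p0 : 0 < e ^- m * c * delta ^+ 2 by rewrite !mulr_gt0 ?invr_gt0 ?exprn_gt0.
  rewrite -lee_pdivlMl// => /le_trans; apply; rewrite -EFinM lee_fin /Cb.
  rewrite le_eqVlt; apply/orP; left; apply/eqP; rewrite (exprS e m).
  by move: (e ^+ m) em => q q0; field; rewrite !gt_eqF.
pose P2 : set (V * V) := (B `*` setT) `&` [set p | A (e^-1 *: (p.1 - p.2))].
pose P3 : set (V * V) := (setT `*` B) `&` [set p | A (e^-1 *: (p.1 - p.2))].
have mA2 : measurable [set p : V * V | A (e^-1 *: (p.1 - p.2))] by exact: (measurable_difference mA').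
have mP2 : measurable P2 by apply: measurableI => //; exact: measurableX.
have mP3 : measurable P3 by apply: measurableI => //; exact: measurableX.
have muA' : (mu [set x | A (e^-1 *: x)] = (e ^+ m * a)%:E)%E.
  rewrite (lebesgue_rV_affine 0 e0 mA') EFinM fineK//; congr (_ * mu _)%E.
  by apply/seteqP; split => x /=; rewrite addr0 scalerA mulVf ?gt_eqF// scale1r.
have A'N p : A (e^-1 *: (p.1 - p.2)) -> [set x | A (e^-1 *: x)] (p.2 - p.1).
  by move=> /AN /=; rewrite -scalerN opprB.
have muBA : ((Ca * e)%:E * mu [set x | A (e^-1 *: x)] = (Ca * a * e ^+ m.+1)%:E)%E.
  by rewrite muA' -EFinM exprS; congr (_%:E); ring.
have muP2 : (mu2 P2 <= (Ca * a * e ^+ m.+1)%:E)%E.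
  rewrite -muBA; apply: mu2_difference_le => //.
  - by rewrite mulr_ge0// ltW.
  - by move=> p [_ /A'N].
  - move=> h Ah; apply: le_trans muB; apply: le_measure; rewrite ?inE//; last by move=> x [[]].
    have -> : [set x | P2 (x, x + h)] = (fun x => (x, x + h)) @^-1` P2 by [].
    apply: measurable_preimageT => //; apply: measurable_fun_pair => //; exact: measurable_rV_add.
have muP3 : (mu2 P3 <= (Ca * a * e ^+ m.+1)%:E)%E.
  rewrite -muBA; apply: mu2_difference_le => //.
  - by rewrite mulr_ge0// ltW.
  - by move=> p [_ /A'N].
  - move=> h Ah; have := lebesgue_rV_shift_le h mB muB; apply: le_trans.
    apply: le_measure; rewrite ?inE//; last by move=> x [[]].
      have -> : [set x | P3 (x, x + h)] = (fun x => (x, x + h)) @^-1` P3 by [].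
      apply: measurable_preimageT => //; apply: measurable_fun_pair => //; exact: measurable_rV_add.
    exact: measurable_shift.
have mN1 : measurable (N `*` [set: V]) by exact: measurableX.
have mN2 : measurable ([set: V] `*` N) by exact: measurableX.
have muN1 : mu2 (N `*` setT) = 0%E.
  by rewrite product_measure1E// -[X in (X * _)%E]/(mu N) N0 mul0e.
have muN2 : mu2 (setT `*` N) = 0%E.
  by rewrite product_measure1E// -[X in (_ * X)%E]/(mu N) N0 mule0.
have -> : (((Cb + (Ca * a + Ca * a)) * e ^+ m.+1)%:E = (Cb * e ^+ m.+1)%:E +
   (((Ca * a * e ^+ m.+1)%:E + (Ca * a * e ^+ m.+1)%:E) + (0 + 0)))%E.
  by rewrite !add0e adde0 !mulrDl !EFinD.
apply: (@measure_leU _ _ _ _ _ P1 ((P2 `|` P3) `|` ((N `*` setT) `|` (setT `*` N)))) => //.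
- exact: measurable_pairs.
- by apply: measurableU; exact: measurableU.
- move=> [x y] [/= Ox Oy Axy Exy].
  have [Nx|Nx] := pselect (N x); first by right; right; left.
  have [Ny|Ny] := pselect (N y); first by right; right; right.
  have [xB|xB] := pselect (B x); first by right; left; left.
  have [yB|yB] := pselect (B y); first by right; left; right.
  left; split; first by split.
  have wx : well_dist z1 z2 x (g x) < delta.
    by rewrite ltNge; apply/negP => xd; apply: xB; split.
  have wy : well_dist z1 z2 y (g y) < delta.
    by rewrite ltNge; apply/negP => yd; apply: yB; split.
  (* Each value is within [delta] of its well and the wells move by at most [delta] between [x] and
     [y], so the gap [8 * delta] leaves a difference above [5 * delta], more than the [delta]
     required in [P1]. *)
  have [x1 x2] := phase_well (conj Ox Nx) wx; have [y1 y2] := phase_well (conj Oy Ny) wy.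
  have xyr : `|x - y| <= r.
    apply: le_trans Ker; have := AK Axy.
    by rewrite normrZ gtr0_norm ?invr_gt0// ler_pdivrMl// mulrC.
  have := z1r xyr; have := z2r xyr; have := gap Ox; have := gap Oy; rewrite !ler_norml => gy gx /andP[? ?] /andP[? ?].
  rewrite /=; have [Ex|Ex] := pselect (phase N g x).
    have Ey : ~ phase N g y by move=> Ey; apply: Exy.
    move: (x1 Ex) (y2 Ey); rewrite !ltr_norml => /andP[? ?] /andP[? ?].
    rewrite distrC; apply: le_trans (ler_norm _); lra.
  have Ey : phase N g y by apply: contrapT => Ey; apply: Exy.
  move: (x2 Ex) (y1 Ey); rewrite !ltr_norml => /andP[? ?] /andP[? ?].
  apply: le_trans (ler_norm _); lra.
- apply: (@measure_leU _ _ _ _ _ (P2 `|` P3) ((N `*` setT) `|` (setT `*` N))) => //.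
  + by apply: measurableU; exact: measurableU.
  + exact: measurableU.
  + exact: measurableU.
  + by apply: (@measure_leU _ _ _ _ _ P2 P3) => //; exact: measurableU.
  + apply: (@measure_leU _ _ _ _ _ (N `*` setT) (setT `*` N)) => //; first exact: measurableU.
    * by rewrite le_eqVlt; apply/orP; left; apply/eqP.
    * by rewrite le_eqVlt; apply/orP; left; apply/eqP.
Qed.

(** [Y] absorbs the discrepancy between [v] and the well nearest to [g]. The choice [v = 0] with
    constant [Y] gives integrability, and the limit function with [Y] supported on a symmetric
    difference gives convergence. *)
Lemma integral_excess_le (D : R) (eta Ce e M : R) u N g (v Y : V -> R) : 0 < eta -> 0 < Ce ->
  (forall x t, Omega x -> well_dist z1 z2 x t <= eta + Ce * W x t) ->
  mu Omega = D%:E -> 0 < e -> (energy Omega J W e u <= M%:E)%E ->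
  measurable N -> mu N = 0%E -> measurable_fun setT g -> (forall x, (Omega `\` N) x -> g x = u x) ->
  measurable_fun setT Y -> (forall x, 0 <= Y x) ->
  (forall x, (Omega `\` N) x -> `|u x - v x| <= well_dist z1 z2 x (g x) + Y x) ->
  (\int[mu]_(x in Omega) `|u x - v x|%:E <=
   (eta * D + Ce * (e * M))%:E + \int[mu]_(x in Omega) (Y x)%:E)%E.
Proof.
move=> eta0 Ce0 HC OD e0 EM mN N0 mg gu mY Y0 uvY.
have [E1 _] := energy_le e0 EM.
(* The excess of the well distance over [eta], divided by [Ce], is a Borel minorant of the potential
   term. The linearity of the integral is applied to it, and monotonicity then brings in [W]. *)
pose h x := Ce^-1 * (Num.max 0 (well_dist z1 z2 x (g x) - eta) * \1_(Omega `\` N) x).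
have h0 x : 0 <= h x.
  by rewrite mulr_ge0// ?invr_ge0 ?(ltW Ce0)// mulr_ge0// le_max lexx.
have mh : measurable_fun setT h.
  apply: measurable_funM => //; apply: measurable_funM; last first.
    by apply: measurable_indic; exact: measurableD.
  apply: (@measurable_maxr _ _ _ _ (cst 0) (fun x => well_dist z1 z2 x (g x) - eta)) => //.
  by apply: measurable_funB => //; exact: measurable_well_dist.
have hW x : Omega x -> h x <= W x (u x).
  move=> Ox; rewrite /h indicE; case: (boolP (x \in _)) => [/set_mem xN|_]; last by rewrite !mulr0.
  rewrite mulr1 ler_pdivrMl// ge_max mulr_ge0 ?(ltW Ce0)//= lerBlDl -(gu x xN).
  exact: HC.
have Ceh x : 0 <= Ce * h x by rewrite mulr_ge0// ltW.
have eh x : 0 <= eta + Ce * h x by rewrite addr_ge0// ltW.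
have mF : measurable_fun setT (fun x => (eta + Ce * h x + Y x)%:E).
  apply/measurable_EFinP; apply: measurable_funD => //; apply: measurable_funD => //.
  exact: measurable_funM.
apply: (@le_trans _ _ (\int[mu]_(x in Omega) (eta + Ce * h x + Y x)%:E)%E).
  apply: (@le_integral_null _ _ _ _ _ N) => //.
  - by move=> x; rewrite lee_fin addr_ge0.
  - move=> x xN; rewrite lee_fin; apply: le_trans (uvY x xN) _; rewrite lerD2r.
    rewrite /h indicE mem_set// mulr1 mulrA divff ?gt_eqF// mul1r.
    by rewrite -lerBlDl le_max lexx orbT.
under eq_integral do rewrite EFinD.
rewrite ge0_integralD//; last 4 first.
- by move=> x _; rewrite lee_fin.
- by apply/measurable_EFinP; apply: measurable_funTS; apply: measurable_funD => //; exact: measurable_funM.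
- by move=> x _; rewrite lee_fin.
- by apply/measurable_EFinP; exact: measurable_funTS.
apply: leeD => //; under eq_integral do rewrite EFinD.
rewrite ge0_integralD//; last 3 first.
- by move=> x _; rewrite lee_fin ltW.
- by move=> x _; rewrite lee_fin.
- by apply/measurable_EFinP; apply: measurable_funTS; exact: measurable_funM.
rewrite integral_cst// EFinD EFinM; apply: leeD.
  by rewrite -OD.
under eq_integral do rewrite EFinM.
rewrite ge0_integralZl//; last 3 first.
- by apply/measurable_EFinP; exact: measurable_funTS.
- by move=> x _; rewrite lee_fin.
- by rewrite lee_fin ltW.
rewrite EFinM lee_wpmul2l//; first by rewrite lee_fin ltW.
apply: le_trans E1; apply: le_integral_nonmeas => x Ox; rewrite lee_fin//.
exact: hW.
Qed.

End energy_bounds.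

Lemma limf_esup_bounded {R : realType} (f : R -> \bar R) : (limf_esup f 0^'+ < +oo)%E ->
  exists2 M : R, 0 <= M & exists2 e0 : R, 0 < e0 & forall e, 0 < e -> e < e0 -> (f e <= M%:E)%E.
Proof.
move=> /ereal_inf_lt[_ [S S0 <-] Soo].
have [M M0 SM] : exists2 M : R, 0 <= M & (ereal_sup (f @` S) <= M%:E)%E.
  case: (ereal_sup _) Soo => [s| |]// _; last by exists 0 => //; exact: leNye.
  by exists `|s| => //; rewrite lee_fin ler_norm.
exists M => //; have [e0 /= e00 H] := S0; exists e0 => // e e1 e2.
apply: le_trans SM; apply: ereal_sup_ubound; exists e => //.
by apply: H => //=; rewrite sub0r normrN gtr0_norm.
Qed.

Lemma le_cvge0 {R : realType} (f : nat -> \bar R) : (forall n, 0 <= f n)%E ->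
  (forall t : R, 0 < t -> exists N, forall n, (N <= n)%N -> (f n <= t%:E)%E) ->
  f n @[n --> \oo] --> 0%E.
Proof.
move=> f0 H; apply/fine_cvgP; split.
  have [N HN] := H 1 ltr01; exists N => // n /HN fn.
  by rewrite ge0_fin_numE// (le_lt_trans fn)// ltry.
apply/cvgrPdist_le => e e0; have [N HN] := H e e0; exists N => // n /= /HN fn.
rewrite sub0r normrN ger0_norm ?fine_ge0// -lee_fin fineK//.
by rewrite ge0_fin_numE// (le_lt_trans fn)// ltry.
Qed.

Section phases.
Context {R : realType} (m : nat).
Local Notation V := 'rV[R]_m.
Local Notation mu := (lebesgue_rV m : set V -> \bar R).

Lemma lebesgue_measurable_borel (A : set V) : measurable A -> lebesgue_measurable_set A.
Proof. by move=> mA; exists A => //; exists set0; [exact: negligible_set0|rewrite setU0]. Qed.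

Lemma lebesgue_measurable_fun_borel (D : set V) (f : V -> R) : measurable D ->
  measurable_fun setT f -> lebesgue_measurable_fun D f.
Proof.
move=> mD mf Y mY; apply: lebesgue_measurable_borel; apply: measurableI => //.
exact: measurable_preimageT.
Qed.

Lemma phase_dist (Omega N : set V) (z1 z2 g : V -> R) x : z1 x <= z2 x -> (Omega `\` N) x ->
  (phase Omega z1 z2 N g x -> `|g x - z1 x| <= well_dist z1 z2 x (g x)) /\
  (~ phase Omega z1 z2 N g x -> `|g x - z2 x| <= well_dist z1 z2 x (g x)).
Proof.
move=> z12 xON; rewrite /well_dist; split.
  move=> [_ /=]; rewrite ler_pdivlMr// => gx; rewrite le_min lexx/=.
  rewrite ler_norml; apply/andP; split.
    have := ler_norm (g x - z2 x); have := ler_norm (- (g x - z2 x)); rewrite normrN; lra.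
  have := ler_norm (- (g x - z2 x)); rewrite normrN; lra.
move=> np; have {}np : (z1 x + z2 x) / 2 < g x by rewrite ltNge; apply/negP => gx; apply: np.
move: np; rewrite ltr_pdivrMr// => gx; rewrite le_min lexx andbT.
rewrite ler_norml; apply/andP; split; have := ler_norm (g x - z1 x); lra.
Qed.

End phases.

Theorem proposition5p1 (R : realType) (m : nat) (m_gt0 : (0 < m)%N)
  (Omega : set 'rV[R]_m)
  (Omega_open : open Omega) (Omega_connected : connected Omega)
  (Omega_bounded : bounded_set Omega)
  (J : 'rV[R]_m -> R)
  (J_ge0 : forall h, 0 <= J h)
  (J_even : forall h, J (- h) = J h)
  (J_measurable : lebesgue_measurable_fun [set: 'rV[R]_m] J)
  (J_nonzero : ~ {ae lebesgue_rV m, forall h, J h = 0})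
  (J_tail : exists2 rho : R, 0 < rho &
    (\int[lebesgue_rV m]_(h in ~` eball rho) (J h * enorm h)%:E < +oo)%E)
  (W : 'rV[R]_m -> R -> R) (z1 z2 : 'rV[R]_m -> R)
  (W_ge0 : forall x t, 0 <= W x t)
  (HW1 : W1 W z1 z2)
  (HW25 : forall K : set 'rV[R]_m, compact K ->
    exists2 delta : R, 0 < delta <= 1 & W2 z1 z2 K delta /\ W5 W K delta)
  (u_ : R -> 'rV[R]_m -> R)
  (u_measurable : forall eps, 0 < eps -> lebesgue_measurable_fun Omega (u_ eps))
  (u_bounded :
    (limf_esup (fun eps => energy Omega J W eps (u_ eps)) 0^'+ < +oo)%E)
  (eps_ : nat -> R) (eps_gt0 : forall k, 0 < eps_ k)
  (eps_cvg0 : eps_ k @[k --> \oo] --> (0 : R)) :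
  exists2 u : 'rV[R]_m -> R, CP Omega z1 z2 u &
  exists2 sigma : nat -> nat, {homo sigma : i j / (i < j)%N} &
    cvg_L1 Omega (fun k => u_ (eps_ (sigma k))) u.
Proof.
pose mu := (lebesgue_rV m : set 'rV[R]_m -> \bar R).
have mO := open_measurable_rV Omega_open.
have [B OB] : exists B : R, forall x, Omega x -> `|x| <= B.
  by have [B [_ HB]] := Omega_bounded; exists (B + 1); apply: HB; rewrite ltrDl.
pose Kc : set 'rV[R]_m := [set x | `|x| <= B].
have cKc : compact Kc.
  apply: bounded_closed_compact.
    by exists B; split; [exact: num_real|] => B' BB' x /= xB; rewrite (le_trans xB)// ltW.
  apply: (@closed_comp _ _ (fun x : 'rV[R]_m => `|x|) [set t | t <= B]); last exact: closed_le.
  by move=> x _; exact: norm_continuous.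
have [delta /andP[delta0 _] [[gap1 gap2] HW5]] := HW25 _ cKc.
have [cW [_ [Wz [alpha /andP[alpha0 _] [_ hz1 hz2]]]]] := HW1.
have {}alpha0 : 0 < alpha by apply: lt_trans alpha0; rewrite invr_gt0.
have cz1 := holder_continuous alpha0 hz1; have cz2 := holder_continuous alpha0 hz2.
have gap x : Omega x -> 8 * delta < z2 x - z1 x.
  move=> Ox; have := gap1 x (OB x Ox); rewrite distrC gtr0_norm// subr_gt0.
  exact: gap2 (OB x Ox).
have wd (eta : R) : 0 < eta -> exists2 C : R, 0 < C &
    forall x t, Omega x -> well_dist z1 z2 x t <= eta + C * W x t.
  move=> eta0; have [C C0 H] := well_dist_le_potential cKc cW cz1 cz2 W_ge0 Wz delta0 HW5 eta0.
  by exists C => // x t /OB; exact: H.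
have [Z [Z0 Z1 Z2]] : exists Z, [/\ 0 <= Z, forall x, Omega x -> `|z1 x| <= Z & forall x, Omega x -> `|z2 x| <= Z].
  have bnd (z : 'rV[R]_m -> R) : continuous z -> exists Z, forall x, Omega x -> `|z x| <= Z.
    move=> cz; have : compact (z @` Kc) by apply: continuous_compact => //; exact: continuous_subspaceT.
    move=> /compact_bounded[Y [_ HY]]; exists (Y + 1) => x Ox.
    by apply: HY; [rewrite ltrDl|exists x => //; exact: OB].
  have [Y1 HY1] := bnd _ cz1; have [Y2 HY2] := bnd _ cz2.
  exists (`|Y1| + `|Y2|); split; first exact: addr_ge0.
    by move=> x Ox; rewrite (le_trans (HY1 x Ox))// (le_trans (ler_norm _))// lerDl.
  by move=> x Ox; rewrite (le_trans (HY2 x Ox))// (le_trans (ler_norm _))// lerDr.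
have [r r0 [z1r z2r]] : exists2 r : R, 0 < r & (forall x y, `|x - y| <= r -> `|z1 x - z1 y| <= delta) /\
    (forall x y, `|x - y| <= r -> `|z2 x - z2 y| <= delta).
  have [r1 r10 H1] := holder_uniform alpha0 hz1 delta0.
  have [r2 r20 H2] := holder_uniform alpha0 hz2 delta0.
  exists (Num.min r1 r2); first by rewrite lt_min r10.
  by split => x y; rewrite le_min => /andP[? ?]; [exact: H1|exact: H2].
have [M M0 [e0 e00 EM]] := limf_esup_bounded u_bounded.
have [A [K [c [c0 mA A0 [AK AN cJ]]]]] := kernel_set J_ge0 J_even J_measurable J_nonzero.
have [N1 HN1] : exists N1, forall k, (N1 <= k)%N -> eps_ k < e0 /\ K * eps_ k <= r.
  have q0 : 0 < Num.min e0 (r / (`|K| + 1)) by rewrite lt_min e00 divr_gt0// ltr_wpDl.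
  have /cvgrPdist_lt/(_ _ q0)[N _ H] := eps_cvg0; exists N => k /H /=.
  rewrite sub0r normrN gtr0_norm// lt_min => /andP[-> kr]; split => //.
  move: kr; rewrite ltr_pdivlMr ?ltr_wpDl// => /ltW; apply: le_trans.
  rewrite mulrC ler_wpM2l ?(ltW (eps_gt0 k))//.
  by apply: le_trans (ler_norm _) _; rewrite lerDl.
(* Dropping the first [N1] indices makes the energy bound and [K * eps <= r] available at every
   index; [N1] is added back to the final subsequence. *)
pose e_ k := eps_ (k + N1)%N.
have e_gt0 k : 0 < e_ k by exact: eps_gt0.
have e_cvg : e_ k @[k --> \oo] --> (0 : R) by rewrite /e_ (cvg_shiftn N1).
have eEM k : (energy Omega J W (e_ k) (u_ (e_ k)) <= M%:E)%E.
  by apply: EM => //; exact: (HN1 _ (leq_addl _ _)).1.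
have /choice[Ng HNg] : forall k, exists Ng : set 'rV[R]_m * ('rV[R]_m -> R),
    [/\ measurable Ng.1, mu Ng.1 = 0%E, measurable_fun setT Ng.2 &
     forall x, (Omega `\` Ng.1) x -> Ng.2 x = u_ (e_ k) x].
  move=> k; have [N [g [[mN N0] mg gu _]]] := borel_representative mO (u_measurable _ (e_gt0 k)).
  by exists (N, g).
pose E_ k := phase Omega z1 z2 (Ng k).1 (Ng k).2.
have mE k : measurable (E_ k) by have [? ? ? ?] := HNg k; exact: measurable_phase.
have EO k : E_ k `<=` Omega by move=> x [[]].
have d2 : 0 < delta / 2 by rewrite divr_gt0.
have [Cd Cd0 HCd] := wd _ d2.
have [Cp Cp0 HCp] := pairs_energy mO J_ge0 W_ge0 mA AK AN c0 cJ cz1 cz2 delta0 gap Cd0 HCd z1r z2r M0.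
have [cc [L [cc0 L0 HL]]] := jump_chain mO mA AK AN A0.
(* [Cp] may be zero, whereas the compactness argument divides by its constant; hence [Cp + 1]. *)
have Cj0 : 0 < cc * (Cp + 1) by rewrite mulr_gt0// ltr_wpDl.
have jump_le (d : R) : 0 < d -> exists N, forall n (h : 'rV[R]_m), (N <= n)%N -> `|h| <= d ->
    (mu (inner Omega (d + d) `&` jump (E_ n) h) <= (cc * (Cp + 1) * (`|h| + e_ n))%:E)%E.
  move=> d0; have /cvgrPdist_lt/(_ _ (divr_gt0 d0 L0))[N _ H] := e_cvg.
  exists N => n h /H /=; rewrite sub0r normrN gtr0_norm// ltr_pdivlMr// mulrC => /ltW Ln hd.
  have [mN N0 mg gu] := HNg n.
  apply: (HL _ _ _ _ _ (e_gt0 n)) => //; first by rewrite addr_ge0.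
  apply: le_trans (HCp _ _ _ _ (e_gt0 n) (HN1 _ (leq_addl _ _)).2 (eEM n) mN N0 mg gu) _.
  by rewrite lee_fin ler_wpM2r ?exprn_ge0 ?lerDl// ltW.
have [sigma sincr [E [mEE EEO] Ecvg]] := sets_compact Omega_open OB mE EO Cj0 e_cvg jump_le.
have jumpE := jump_limit mE Cj0 e_cvg jump_le sincr mEE Ecvg.
have perE : (perimeter E Omega < +oo)%E.
  apply: (perimeter_lty Omega_open mEE EEO _ (ltW Cj0) jumpE) => x /EEO; exact: OB.
pose u x := if x \in E then z1 x else z2 x.
have mz1 := continuous_measurable_rV cz1; have mz2 := continuous_measurable_rV cz2.
have mu_u : measurable_fun setT u.
  have mem : measurable_fun setT (fun x : 'rV[R]_m => x \in E).
    apply: (measurable_fun_bool true) => //; rewrite setTI.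
    rewrite (_ : _ @^-1` _ = E)//; apply/seteqP; split => x /=; first by move/set_mem.
    by move=> Ex; rewrite mem_set.
  exact: measurable_fun_ifT.
have Ofin : (mu Omega < +oo)%E by apply: bounded_measure_lty OB.
have OD : mu Omega = (fine (mu Omega))%:E by rewrite fineK// ge0_fin_numE.
set D := fine _ in OD.
have D0 : 0 <= D by exact: fine_ge0.
have z12 x : Omega x -> z1 x <= z2 x by move=> /OB/gap2/ltW.
have uZ x : Omega x -> `|u x| <= Z by move=> Ox; rewrite /u; case: ifP => _; [exact: Z1|exact: Z2].
have uL1 : in_L1 Omega u.
  split; first exact: lebesgue_measurable_fun_borel.
  apply: (@le_lt_trans _ _ (\int[mu]_(x in Omega) (cst Z%:E x))%E).
    by apply: le_integral_nonmeas => // x Ox; rewrite lee_fin; exact: uZ.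
  by rewrite integral_cst// -[X in (_ * X)%E]/(mu Omega) OD -EFinM ltry.
exists u.
  split; first exact: lebesgue_measurable_fun_borel.
  exists E; split.
  - by split => //; apply: lebesgue_measurable_borel; exact: measurableI.
  - by apply: aeW => x [_ Ex]; rewrite /u mem_set.
  - by apply: aeW => x [_ Ex]; rewrite /u memNset.
exists (fun k => sigma k + N1)%N; first by move=> i j ij; rewrite ltn_add2r; exact: sincr.
have ukL1 k : in_L1 Omega (u_ (e_ k)).
  split; first exact: u_measurable.
  (* Any slack will do for finiteness, here 1; the values [u] are compared with 0, the wells being
     bounded by [Z] on [Omega]. *)
  have [mN N0 mg gu] := HNg k; have [C C0 HC] := wd 1 ltr01.
  have := @integral_excess_le _ _ _ _ _ mO J_ge0 W_ge0 z1 z2 cz1 cz2 D 1 C (e_ k) M (u_ (e_ k)) _ _ (cst 0) (cst Z)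
    ltr01 C0 HC OD (e_gt0 k) (eEM k) mN N0 mg gu.
  move=> /(_ (measurable_cst _) (fun=> Z0)) H.
  under eq_integral do rewrite -[u_ _ _]subr0.
  apply: le_lt_trans (H _) _; last first.
    rewrite -[X in (_ + X)%E]/(\int[mu]_(x in Omega) cst Z%:E x)%E.
    by rewrite integral_cst// -[X in (_ + _ * X)%E]/(mu Omega) OD -EFinM -EFinD ltry.
  move=> x xON; rewrite subr0 -(gu _ xON).
  have [x1 x2] := phase_dist (Ng k).2 (z12 x xON.1) xON.
  have [Ex|Ex] := pselect (phase Omega z1 z2 (Ng k).1 (Ng k).2 x).
    rewrite -[X in `|X|](subrK (z1 x)); apply: le_trans (ler_normD _ _) _.
    by apply: lerD; [exact: x1|exact: (Z1 _ xON.1)].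
  rewrite -[X in `|X|](subrK (z2 x)); apply: le_trans (ler_normD _ _) _.
  by apply: lerD; [exact: x2|exact: (Z2 _ xON.1)].
split => // [k|]; first exact: ukL1.
apply: le_cvge0 => [n|t t0]; first by apply: integral_ge0 => x _; rewrite lee_fin.
have t3 : 0 < t / 3 by rewrite divr_gt0.
(* Each of the three errors gets [t / 3]: the slack [eta * D], the potential term [C * (e_ k * M)]
   and the mismatch of the phases. The summands 1 keep the denominators positive. *)
pose eta := t / 3 / (D + 1).
have D1 : 0 < D + 1 by rewrite ltr_wpDl.
have eta0 : 0 < eta by rewrite divr_gt0.
have etaD : eta * D <= t / 3 by rewrite /eta mulrAC ler_pdivrMr// ler_wpM2l ?(ltW t3)// lerDl.
have [C C0 HC] := wd eta eta0.
have CM : 0 < C * (M + 1) by rewrite mulr_gt0// ltr_wpDl.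
have /cvgrPdist_lt/(_ _ (divr_gt0 t3 CM))[N2 _ HN2] := e_cvg.
have Z2' : 0 < 2 * Z + 1 by rewrite ltr_wpDl// mulr_ge0.
have [N3 HN3] := cvge0_le Ecvg (divr_gt0 t3 Z2').
exists (maxn N2 N3) => n; rewrite geq_max => /andP[n2 n3].
have sn : (n <= sigma n)%N.
  by elim: n {n2 n3} => // k IH; exact: leq_ltn_trans IH (sincr _ _ (ltnSn k)).
set k := sigma n; have [mN N0 mg gu] := HNg k.
have mS : measurable (E_ k `+` E) by exact: measurable_setY.
(* Where [E_ k] and [E] disagree, [u] takes the value of the other well, at distance at most [2 * Z]
   from the one nearest to [g]. *)
pose Y x : R := 2 * Z * \1_(E_ k `+` E) x.
have mY : measurable_fun setT Y by apply: measurable_funM => //; exact: measurable_indic.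
have Y0 x : 0 <= Y x by rewrite mulr_ge0// mulr_ge0.
have := @integral_excess_le _ _ _ _ _ mO J_ge0 W_ge0 z1 z2 cz1 cz2 D eta C (e_ k) M (u_ (e_ k)) _ _ u Y
    eta0 C0 HC OD (e_gt0 k) (eEM k) mN N0 mg gu mY Y0.
move=> H; apply: le_trans (H _) _.
  move=> x xON; rewrite -(gu _ xON).
  have [x1 x2] := phase_dist (Ng k).2 (z12 x xON.1) xON.
  have zz : `|z1 x - z2 x| <= 2 * Z.
    by rewrite mulr_natl mulr2n; apply: le_trans (ler_normB _ _) _; apply: lerD; [exact: (Z1 _ xON.1)|exact: (Z2 _ xON.1)].
  rewrite /Y indicE /u.
  have [Ex|Ex] := pselect (E_ k x).
    have {}x1 := x1 Ex; case: ifPn => [/set_mem EE|/negP EE].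
      by apply: le_trans x1 _; rewrite lerDl mulr_ge0// mulr_ge0.
    rewrite mem_set; last by left; split => // ?; apply: EE; rewrite inE.
    rewrite mulr1 -[X in `|X|](subrKA (z1 x)); apply: le_trans (ler_normD _ _) _.
    exact: lerD.
  have {}x2 := x2 Ex; case: ifPn => [/set_mem EE|/negP EE]; last first.
    by apply: le_trans x2 _; rewrite lerDl mulr_ge0// mulr_ge0.
  rewrite mem_set; last by right; split.
  rewrite mulr1 -[X in `|X|](subrKA (z2 x)); apply: le_trans (ler_normD _ _) _.
  by apply: lerD => //; rewrite distrC.
have IY : (\int[mu]_(x in Omega) (Y x)%:E <= (t / 3)%:E)%E.
  under eq_integral do rewrite EFinM.
  rewrite ge0_integralZl//; last 2 first.
  - by apply/measurable_EFinP; exact: measurable_indic.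
  - by rewrite lee_fin mulr_ge0.
  rewrite integral_indic//.
  apply: (@le_trans _ _ ((2 * Z + 1)%:E * (t / 3 / (2 * Z + 1))%:E)%E).
    apply: lee_pmul => //; first by rewrite lee_fin mulr_ge0.
    - by rewrite lee_fin lerDl.
    - apply: le_trans (HN3 n n3); apply: le_measure; rewrite ?inE//; exact: measurableI.
  by rewrite -EFinM lee_fin mulrC mulfVK// gt_eqF.
apply: (@le_trans _ _ ((t / 3 + t / 3)%:E + (t / 3)%:E)%E).
  apply: leeD => //; rewrite lee_fin; apply: lerD => //.
  have := HN2 _ (leq_trans n2 sn); rewrite /= sub0r normrN gtr0_norm// => /ltW.
  rewrite ler_pdivlMr//; apply: le_trans; rewrite mulrCA.
  by rewrite ler_wpM2l ?(ltW (e_gt0 k))// ler_wpM2l ?(ltW C0)// lerDl.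
by rewrite -EFinD lee_fin; lra.
Qed.
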